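(* Let $k$ be an algebraically closed field and let $\mathbb{H}\le\mathbb{G}$ be an embedding of linearly reductive quantum groups over $k$. Let $C(\mathbb{G},\mathbb{H})$ be the relative chain group, i.e. the group defined by generators $g_V$, $V\in\widehat{\mathbb{G}}$, and one relation $g_U=g_Vg_W$ for all $U,V,W\in\widehat{\mathbb{G}}$ such that $U$ and $V\otimes W$ have common simple constituents over $\mathbb{H}$ (i.e. $\mathrm{hom}_{\mathbb{H}}(U,V\otimes W)\ne 0$). Let $Z(\mathbb{G},\mathbb{H})=Z(\mathbb{G})\cap\mathbb{H}$ be the relative center. Then the map $$C(\mathbb{G},\mathbb{H})\to\widehat{Z(\mathbb{G},\mathbb{H})},\qquad g_V\mapsto W,\quad\text{where } \mathrm{Res}^{\mathbb{G}}_{Z(\mathbb{G},\mathbb{H})}V\cong\text{ a direct sum of copies of }W,$$ is a group isomorphism.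
   Context: All algebras, coalgebras and Hopf algebras are over a fixed algebraically closed field $k$. A (linear algebraic) quantum group $\mathbb{G}$ is a formal object dual to a Hopf algebra $\mathcal{O}(\mathbb{G})$; it is linearly reductive if $\mathcal{O}(\mathbb{G})$ is cosemisimple. An embedding (quantum subgroup) $\mathbb{H}\le\mathbb{G}$ means a surjective Hopf algebra morphism $\mathcal{O}(\mathbb{G})\to\mathcal{O}(\mathbb{H})$. A representation of $\mathbb{G}$ is a right $\mathcal{O}(\mathbb{G})$-comodule; $\widehat{\mathbb{G}}$ is the set of isomorphism classes of simple right $\mathcal{O}(\mathbb{G})$-comodules. $\mathrm{Res}^{\mathbb{G}}_{\mathbb{H}}$ denotes corestriction of comodules along $\mathcal{O}(\mathbb{G})\to\mathcal{O}(\mathbb{H})$, and $\mathrm{hom}_{\mathbb{H}}(U,V\otimes W)$ is the space of $\mathcal{O}(\mathbb{H})$-comodule morphisms between the corestrictions. Center: for $\mathbb{G}$ linearly reductive, $Z(\mathbb{G})\le\mathbb{G}$ is the quantum subgroup dual to the largest Hopf algebra quotient $\pi:\mathcal{O}(\mathbb{G})\to\mathcal{O}(Z(\mathbb{G}))$ that is central in the sense that $$\pi(x_1)\otimes x_2=\pi(x_2)\otimes x_1\in\mathcal{O}(Z(\mathbb{G}))\otimes\mathcal{O}(\mathbb{G})\quad\text{for all }x\in\mathcal{O}(\mathbb{G})$$ (Sweedler notation $\Delta(x)=x_1\otimes x_2$); ''largest'' means that every other central Hopf algebra quotient of $\mathcal{O}(\mathbb{G})$ factors through it. Relative center: $Z(\mathbb{G},\mathbb{H}):=Z(\mathbb{G})\cap\mathbb{H}$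 is the intersection of the two quantum subgroups, i.e. the largest quantum subgroup of $\mathbb{G}$ contained in both; its Hopf algebra is the quotient of $\mathcal{O}(\mathbb{G})$ by the Hopf ideal $\ker(\mathcal{O}(\mathbb{G})\to\mathcal{O}(Z(\mathbb{G})))+\ker(\mathcal{O}(\mathbb{G})\to\mathcal{O}(\mathbb{H}))$. It is linearly reductive. Every irreducible $\mathbb{G}$-representation restricts to $Z(\mathbb{G})$, and hence to $Z(\mathbb{G},\mathbb{H})$, as a direct sum of copies of a single one-dimensional representation. All simple $\mathcal{O}(Z(\mathbb{G},\mathbb{H}))$-comodules are one-dimensional, and $\widehat{Z(\mathbb{G},\mathbb{H})}$ is a group under tensor product (equivalently, the group of grouplike elements of $\mathcal{O}(Z(\mathbb{G},\mathbb{H}))$). *)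

(* Defs.v *)
From HB Require Import structures.
From mathcomp Require Import all_boot all_order all_algebra generic_quotient.
From mathcomp Require Import boolp.

Set Implicit Arguments.
Unset Strict Implicit.
Unset Printing Implicit Defensive.

Import GRing.Theory.
Local Open Scope ring_scope.
Local Open Scope quotient_scope.

Section TensorRel.
Variables (k : fieldType) (U V : lmodType k).

(* [:: (u1, v1); ...; (un, vn)] stands for the sum of the ui ⊗ vi. *)
Inductive tens_rel : seq (U * V) -> seq (U * V) -> Prop :=
| tens_refl s : tens_rel s s
| tens_sym s t : tens_rel s t -> tens_rel t s
| tens_trans t s r : tens_rel s t -> tens_rel t r -> tens_rel s r
| tens_cat s s' t t' :
    tens_rel s s' -> tens_rel t t' -> tens_rel (s ++ t) (s' ++ t')
| tens_comm s t : tens_rel (s ++ t) (t ++ s)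
| tens_relDl u u' v : tens_rel [:: (u + u', v)] [:: (u, v); (u', v)]
| tens_relDr u v v' : tens_rel [:: (u, v + v')] [:: (u, v); (u, v')]
| tens_relZ a u v : tens_rel [:: (a *: u, v)] [:: (u, a *: v)]
| tens_rel0 v : tens_rel [:: (0, v)] [::].

Definition tens_relb (s t : seq (U * V)) : bool := `[< tens_rel s t >].

Lemma tens_relb_refl : reflexive tens_relb.
Proof. by move=> s; apply/asboolP; apply: tens_refl. Qed.

Lemma tens_relb_sym : symmetric tens_relb.
Proof. by move=> s t; apply/asboolP/asboolP => /tens_sym. Qed.

Lemma tens_relb_trans : transitive tens_relb.
Proof.
by move=> t s r /asboolP st /asboolP tr; apply/asboolP; apply: tens_trans tr.
Qed.

Canonical tens_equiv :=
  EquivRel tens_relb tens_relb_refl tens_relb_sym tens_relb_trans.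

Definition tensor : Type := {eq_quot tens_equiv}.
HB.instance Definition _ := Choice.on tensor.
HB.instance Definition _ := Quotient.on tensor.
HB.instance Definition _ := EqQuotient.on tensor.

End TensorRel.

Section Tensor.
Variables (k : fieldType) (U V : lmodType k).
Local Notation T := (tensor U V).
Implicit Types (s t : seq (U * V)) (x y z : T).

Definition tens_class s : T := \pi_T s.

Lemma tens_classP s t : tens_class s = tens_class t <-> tens_rel s t.
Proof.
rewrite /tens_class; split.
  by move=> /eqP; rewrite eqmodE => /asboolP.
by move=> st; apply/eqP; rewrite eqmodE; apply/asboolP.
Qed.

Lemma tens_classK x : tens_class (repr x) = x.
Proof. exact: reprK. Qed.

Lemma tens_repr s : tens_rel (repr (tens_class s)) s.
Proof. by apply/tens_classP; rewrite tens_classK. Qed.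

Definition pure (u : U) (v : V) : T := tens_class [:: (u, v)].

Definition tens_zero : T := tens_class [::].
Definition tens_add x y : T := tens_class (repr x ++ repr y).
Definition tens_scale (a : k) x : T :=
  tens_class [seq (a *: p.1, p.2) | p <- repr x].
Definition tens_opp x : T := tens_scale (-1) x.

Lemma tens_addE s t :
  tens_add (tens_class s) (tens_class t) = tens_class (s ++ t).
Proof. by apply/tens_classP; apply: tens_cat; apply: tens_repr. Qed.

Lemma tens_rel_scale a s t : tens_rel s t ->
  tens_rel [seq (a *: p.1, p.2) | p <- s] [seq (a *: p.1, p.2) | p <- t].
Proof.
elim=> {s t} /=.
- by move=> s; apply: tens_refl.
- by move=> s t _; apply: tens_sym.
- by move=> t s r _ + _; apply: tens_trans.
- by move=> s s' t t' _ h _ h'; rewrite !map_cat; apply: tens_cat.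
- by move=> s t; rewrite !map_cat; apply: tens_comm.
- by move=> u u' v; rewrite scalerDr; apply: tens_relDl.
- by move=> u v v'; apply: tens_relDr.
- by move=> b u v; rewrite scalerA mulrC -scalerA; apply: tens_relZ.
- by move=> v; rewrite scaler0; apply: tens_rel0.
Qed.

Lemma tens_scaleE a s :
  tens_scale a (tens_class s) = tens_class [seq (a *: p.1, p.2) | p <- s].
Proof. by apply/tens_classP; apply: tens_rel_scale; apply: tens_repr. Qed.

Lemma tens_addA : associative tens_add.
Proof.
move=> x y z; rewrite -[x]tens_classK -[y]tens_classK -[z]tens_classK.
by rewrite !tens_addE catA.
Qed.

Lemma tens_addC : commutative tens_add.
Proof.
move=> x y; rewrite -[x]tens_classK -[y]tens_classK !tens_addE.
by apply/tens_classP; apply: tens_comm.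
Qed.

Lemma tens_add0 : left_id tens_zero tens_add.
Proof. by move=> x; rewrite -[x]tens_classK tens_addE. Qed.

Lemma tens_class_cons p s :
  tens_class (p :: s) = tens_add (pure p.1 p.2) (tens_class s).
Proof. by case: p => u v; rewrite /pure tens_addE. Qed.

Lemma tens_pure0 v : pure 0 v = tens_zero.
Proof. by apply/tens_classP; apply: tens_rel0. Qed.

Lemma tens_pureDl u u' v : pure (u + u') v = tens_add (pure u v) (pure u' v).
Proof. by rewrite tens_addE; apply/tens_classP; apply: tens_relDl. Qed.

Lemma tens_scalerDl x : {morph tens_scale^~ x : a b / a + b >-> tens_add a b}.
Proof.
move=> a b; rewrite -[x]tens_classK !tens_scaleE.
elim: (repr x) => [|p s IH] /=; first by rewrite tens_add0.
rewrite !tens_class_cons /= IH scalerDl tens_pureDl -!tens_addA.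
by congr (tens_add _ _); rewrite !tens_addA; congr (tens_add _ _); apply: tens_addC.
Qed.

Lemma tens_scale0 x : tens_scale 0 x = tens_zero.
Proof.
rewrite -[x]tens_classK tens_scaleE; elim: (repr x) => [//|p s IH] /=.
by rewrite tens_class_cons IH /= scale0r tens_pure0 tens_add0.
Qed.

Lemma tens_scale1 : left_id 1 tens_scale.
Proof.
move=> x; rewrite -[x]tens_classK tens_scaleE; congr tens_class.
by rewrite -[RHS]map_id; apply: eq_map => -[u v]; rewrite /= scale1r.
Qed.

Lemma tens_addN : left_inverse tens_zero tens_opp tens_add.
Proof.
move=> x; rewrite -{2}[x]tens_scale1 /tens_opp -tens_scalerDl.
by rewrite addNr tens_scale0.
Qed.

HB.instance Definition _ :=
  GRing.isZmodule.Build T tens_addA tens_addC tens_add0 tens_addN.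

Lemma tens_scalerA a b x :
  tens_scale a (tens_scale b x) = tens_scale (a * b) x.
Proof.
rewrite -[x]tens_classK !tens_scaleE -map_comp; congr tens_class.
by apply: eq_map => -[u v]; rewrite /= scalerA.
Qed.

Lemma tens_scalerDr : right_distributive tens_scale +%R.
Proof.
move=> a x y; rewrite -[x]tens_classK -[y]tens_classK.
by rewrite /GRing.add /= !(tens_addE, tens_scaleE) map_cat.
Qed.

HB.instance Definition _ := GRing.Zmodule_isLmodule.Build k T
  tens_scalerA tens_scale1 tens_scalerDr tens_scalerDl.

End Tensor.

Arguments pure {k U V} u v.
Notation "u ⊗ v" := (pure u v) (at level 40, left associativity) : ring_scope.

Section TensorTheory.
Variables (k : fieldType).
Implicit Types U V W M : lmodType k.

Definition bilin U V M (f : U -> V -> M) : Prop :=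
  (forall v, linear (f^~ v)) /\ (forall u, linear (f u)).

Lemma pure_bilin U V : bilin (@pure k U V).
Proof.
split=> [v a u u'|u a v v'].
  rewrite tens_pureDl; congr (_ + _).
  by rewrite /GRing.scale /= /pure tens_scaleE.
have -> : a *: (u ⊗ v) = u ⊗ (a *: v).
  by rewrite /GRing.scale /= /pure tens_scaleE; apply/tens_classP/tens_relZ.
by rewrite /GRing.add /= /pure tens_addE; apply/tens_classP/tens_relDr.
Qed.

Definition tens_lift U V M (f : U -> V -> M) (x : tensor U V) : M :=
  \sum_(p <- repr x) f p.1 p.2.

Section Lift.
Variables (U V M : lmodType k) (f : U -> V -> M).
Hypothesis f_bilin : bilin f.

Lemma bilin_lin1 v : exists g : {linear U -> M}, forall u, f u v = g u.
Proof.
pose m := GRing.isLinear.Build k U M *:%R (f^~ v) (f_bilin.1 v).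
by pose g : {linear U -> M} := HB.pack (f^~ v) m; exists g.
Qed.

Lemma bilin_lin2 u : exists g : {linear V -> M}, forall v, f u v = g v.
Proof.
pose m := GRing.isLinear.Build k V M *:%R (f u) (f_bilin.2 u).
by pose g : {linear V -> M} := HB.pack (f u) m; exists g.
Qed.

Lemma tens_rel_lift s t : tens_rel s t ->
  \sum_(p <- s) f p.1 p.2 = \sum_(p <- t) f p.1 p.2.
Proof.
elim=> {s t} //=.
- by move=> t s r _ -> _ ->.
- by move=> s s' t t' _ IH _ IH'; rewrite !big_cat IH IH'.
- by move=> s t; rewrite !big_cat /= addrC.
- move=> u u' v; rewrite !big_cons !big_nil /= !addr0.
  by have [g gE] := bilin_lin1 v; rewrite !gE linearD.
- move=> u v v'; rewrite !big_cons !big_nil /= !addr0.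
  by have [g gE] := bilin_lin2 u; rewrite !gE linearD.
- move=> a u v; rewrite !big_cons !big_nil /= !addr0.
  have [g gE] := bilin_lin1 v; have [h hE] := bilin_lin2 u.
  by rewrite gE hE !linearZ_LR -gE -hE.
- move=> v; rewrite !big_cons !big_nil /= addr0.
  by have [g gE] := bilin_lin1 v; rewrite gE linear0.
Qed.

Lemma tens_lift_class s :
  tens_lift f (tens_class s) = \sum_(p <- s) f p.1 p.2.
Proof. exact/tens_rel_lift/tens_repr. Qed.

Lemma tens_lift_pure u v : tens_lift f (u ⊗ v) = f u v.
Proof. by rewrite tens_lift_class big_seq1. Qed.

Lemma tens_lift_linear : linear (tens_lift f).
Proof.
move=> a x y; rewrite -[x]tens_classK -[y]tens_classK.
have -> : a *: tens_class (repr x) + tens_class (repr y) =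
    tens_class ([seq (a *: p.1, p.2) | p <- repr x] ++ repr y).
  by rewrite /GRing.add /GRing.scale /= tens_scaleE tens_addE.
rewrite !tens_lift_class big_cat big_map /= scaler_sumr; congr (_ + _).
apply: eq_bigr => p _; have [g gE] := bilin_lin1 p.2.
by rewrite !gE linearZ_LR.
Qed.

End Lift.

Lemma tensE U V (x : tensor U V) : x = \sum_(p <- repr x) p.1 ⊗ p.2.
Proof.
rewrite -{1}[x]tens_classK; elim: (repr x) => [|p s IH].
  by rewrite big_nil.
by rewrite big_cons tens_class_cons IH.
Qed.

Lemma tens_ext U V M (f g : tensor U V -> M) : linear f -> linear g ->
  (forall u v, f (u ⊗ v) = g (u ⊗ v)) -> f =1 g.
Proof.
move=> fl gl fg x.
pose mf := GRing.isLinear.Build k (tensor U V) M *:%R f fl.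
pose mg := GRing.isLinear.Build k (tensor U V) M *:%R g gl.
pose f' : {linear tensor U V -> M} := HB.pack f mf.
pose g' : {linear tensor U V -> M} := HB.pack g mg.
rewrite -[f]/(f' : _ -> _) -[g]/(g' : _ -> _) [x]tensE !linear_sum.
by apply: eq_bigr => p _; apply: fg.
Qed.

Definition tens_map U V U' V' (f : U -> U') (g : V -> V') :
    tensor U V -> tensor U' V' :=
  tens_lift (fun u v => f u ⊗ g v).

Definition tens_swap U V : tensor U V -> tensor V U :=
  tens_lift (fun u v => v ⊗ u).

Definition tens_assoc U V W : tensor (tensor U V) W -> tensor U (tensor V W) :=
  tens_lift (fun x w => tens_lift (fun u v => u ⊗ (v ⊗ w)) x).

(* The product of the algebra A ⊗ A. *)
Definition tens_mul (A : algType k) (x y : tensor A A) : tensor A A :=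
  tens_lift (fun a b => tens_lift (fun c d => (a * c) ⊗ (b * d)) y) x.

(* The bilinear map sending (v ⊗ a, w ⊗ b) to (v ⊗ w) ⊗ m a b. *)
Definition tens_cross V W (P Q S : lmodType k) (m : P -> Q -> S)
    (x : tensor V P) (y : tensor W Q) : tensor (tensor V W) S :=
  tens_lift (fun v a => tens_lift (fun w b => (v ⊗ w) ⊗ m a b) y) x.

End TensorTheory.

HB.mixin Record isCoalgebra (k : fieldType) C of GRing.Lmodule k C := {
  comul : {linear C -> tensor C C};
  counit : {linear C -> k^o};
  comulA : forall c : C,
    tens_assoc (tens_map comul idfun (comul c))
    = tens_map idfun comul (comul c);
  counitl : forall c : C, tens_lift (fun x y => counit x *: y) (comul c) = c;
  counitr : forall c : C, tens_lift (fun x y => counit y *: x) (comul c) = c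
}.

#[short(type="coalgType")]
HB.structure Definition Coalgebra (k : fieldType) :=
  {C of isCoalgebra k C & GRing.Lmodule k C}.

HB.mixin Record isHopf (k : fieldType) A
    of GRing.Algebra k A & Coalgebra k A := {
  comul1 : comul (1 : A) = (1 : A) ⊗ (1 : A);
  comulM : forall x y : A, comul (x * y) = tens_mul (comul x) (comul y);
  counit1 : counit (1 : A) = 1;
  counitM : forall x y : A, counit (x * y) = counit x * counit y;
  antipode : {linear A -> A};
  antipodel : forall x : A,
    tens_lift (fun a b => antipode a * b) (comul x) = counit x *: (1 : A);
  antipoder : forall x : A,
    tens_lift (fun a b => a * antipode b) (comul x) = counit x *: (1 : A)
}.

#[short(type="hopfType")]
HB.structure Definition Hopf (k : fieldType) :=
  {A of isHopf k A & GRing.Algebra k A & Coalgebra k A}.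

Record hopfMor (k : fieldType) (A B : hopfType k) := HopfMor {
  hopf_fun :> {lrmorphism A -> B};
  hopf_comul : forall x, comul (hopf_fun x) = tens_map hopf_fun hopf_fun (comul x);
  hopf_counit : forall x, counit (hopf_fun x) = counit x;
  hopf_antipode : forall x, antipode (hopf_fun x) = hopf_fun (antipode x)
}.

Section TensorMaps.
Variable k : fieldType.
Implicit Types U V W M : lmodType k.

Lemma tens_map_bilin U V U' V' (f : {linear U -> U'}) (g : {linear V -> V'}) :
  bilin (fun u v => f u ⊗ g v).
Proof.
by split=> [v|u] a x y; rewrite linearP ?((pure_bilin _ _).1, (pure_bilin _ _).2).
Qed.

Lemma tens_map_pure U V U' V' (f : {linear U -> U'}) (g : {linear V -> V'}) u v :
  tens_map f g (u ⊗ v) = f u ⊗ g v.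
Proof. exact: tens_lift_pure (tens_map_bilin f g) _ _. Qed.

Lemma tens_map_linear U V U' V' (f : {linear U -> U'}) (g : {linear V -> V'}) :
  linear (tens_map f g).
Proof. exact: tens_lift_linear (tens_map_bilin f g). Qed.

HB.instance Definition _ U V U' V' (f : {linear U -> U'})
    (g : {linear V -> V'}) :=
  GRing.isLinear.Build k (tensor U V) (tensor U' V') *:%R (tens_map f g)
    (tens_map_linear f g).

Lemma tens_map_comp U V U' V' U'' V'' (f : {linear U -> U'})
    (g : {linear V -> V'}) (f' : {linear U' -> U''}) (g' : {linear V' -> V''}) x :
  tens_map f' g' (tens_map f g x) = tens_map (f' \o f) (g' \o g) x.
Proof.
apply: (tens_ext (f := tens_map f' g' \o tens_map f g)) => [||u v /=].
- exact: linearP.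
- exact: linearP.
by rewrite !tens_map_pure.
Qed.

Lemma eq_tens_map U V U' V' (f f' : U -> U') (g g' : V -> V') :
  f =1 f' -> g =1 g' -> tens_map f g =1 tens_map f' g'.
Proof. by move=> ff' gg' x; apply: eq_bigr => p _; rewrite ff' gg'. Qed.

Lemma eq_tens_lift U V M (f f' : U -> V -> M) :
  f =2 f' -> tens_lift f =1 tens_lift f'.
Proof. by move=> ff' x; apply: eq_bigr => p _; rewrite ff'. Qed.

Lemma tens_lift_map U V U' V' M (f : {linear U -> U'}) (g : {linear V -> V'})
    (h : U' -> V' -> M) : bilin h -> forall x,
  tens_lift h (tens_map f g x) = tens_lift (fun u v => h (f u) (g v)) x.
Proof.
move=> hb; have hb' : bilin (fun u v => h (f u) (g v)).
  by split=> [v|u] a x y; rewrite linearP ?(hb.1, hb.2).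
have l1 := tens_lift_linear hb; have l2 := tens_lift_linear hb'.
apply: (tens_ext (f := tens_lift h \o tens_map f g)) => //.
  by move=> a x y /=; rewrite linearP l1.
by move=> u v /=; rewrite tens_map_pure !tens_lift_pure.
Qed.

Lemma tens_assoc_bilin2 U V W (w : W) :
  bilin (fun (u : U) (v : V) => u ⊗ (v ⊗ w)).
Proof.
split=> [v|u] a x y; first by rewrite (pure_bilin _ _).1.
by rewrite (pure_bilin _ _).1 (pure_bilin _ _).2.
Qed.

Lemma tens_assoc_bilin U V W :
  bilin (fun (x : tensor U V) (w : W) =>
    tens_lift (fun u v => u ⊗ (v ⊗ w)) x).
Proof.
split=> [w|x]; first exact: tens_lift_linear (tens_assoc_bilin2 _ _ _).
move=> a w w'; rewrite [x]tensE.
rewrite /tens_lift scaler_sumr -big_split; apply: eq_bigr => p _ /=.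
by rewrite !(pure_bilin _ _).2.
Qed.

Lemma tens_assoc_linear U V W : linear (@tens_assoc k U V W).
Proof. exact: tens_lift_linear (tens_assoc_bilin _ _ _). Qed.

HB.instance Definition _ U V W :=
  GRing.isLinear.Build k (tensor (tensor U V) W) (tensor U (tensor V W)) *:%R
    (@tens_assoc k U V W) (@tens_assoc_linear U V W).

Lemma tens_assoc_pure U V W (u : U) (v : V) (w : W) :
  tens_assoc ((u ⊗ v) ⊗ w) = u ⊗ (v ⊗ w).
Proof.
by rewrite /tens_assoc (tens_lift_pure (tens_assoc_bilin _ _ _))
  (tens_lift_pure (tens_assoc_bilin2 _ _ _)).
Qed.

Lemma tens_ext3 U V W M (f g : tensor (tensor U V) W -> M) :
  linear f -> linear g ->
  (forall u v w, f ((u ⊗ v) ⊗ w) = g ((u ⊗ v) ⊗ w)) -> f =1 g.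
Proof.
move=> fl gl fg; apply: tens_ext => // x w.
apply: (tens_ext (f := fun x => f (x ⊗ w)) (g := fun x => g (x ⊗ w))).
- by move=> a y z; rewrite (pure_bilin _ _).1 fl.
- by move=> a y z; rewrite (pure_bilin _ _).1 gl.
by move=> u v; apply: fg.
Qed.

Lemma tens_assoc_map U V W U' V' W' (f : {linear U -> U'})
    (g : {linear V -> V'}) (h : {linear W -> W'}) x :
  tens_assoc (tens_map (tens_map f g) h x)
  = tens_map f (tens_map g h) (tens_assoc x).
Proof.
apply: (tens_ext3 (f := @tens_assoc k U' V' W' \o tens_map (tens_map f g) h)
  (g := tens_map f (tens_map g h) \o @tens_assoc k U V W)) => [||u v w /=].
- exact: linearP.
- exact: linearP.
by do 3?rewrite !(tens_map_pure, tens_assoc_pure) /=.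
Qed.

Lemma bilin_comp U V U' V' M (h : U' -> V' -> M) (f : U -> U') (g : V -> V') :
  bilin h -> linear f -> linear g -> bilin (fun u v => h (f u) (g v)).
Proof. by move=> hb fl gl; split=> [v|u] a x y; rewrite ?fl ?gl ?hb.1 ?hb.2. Qed.

Lemma linear_bilin U V M M' (h : U -> V -> M) (l : M -> M') :
  bilin h -> linear l -> bilin (fun u v => l (h u v)).
Proof. by move=> hb ll; split=> [v|u] a x y; rewrite ?hb.1 ?hb.2 ll. Qed.

Lemma bilin_ext U V U' V' M (f g : tensor U V -> tensor U' V' -> M) :
  bilin f -> bilin g ->
  (forall u v u' v', f (u ⊗ v) (u' ⊗ v') = g (u ⊗ v) (u' ⊗ v')) ->
  f =2 g.
Proof.
move=> fb gb fg x y.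
apply: (tens_ext (fb.1 y) (gb.1 y)) => u v.
by apply: (tens_ext (fb.2 _) (gb.2 _)) => u' v'; apply: fg.
Qed.

Lemma tens_lift2_bilin U V U' V' M (h : U -> V -> U' -> V' -> M) :
  (forall u v, bilin (h u v)) -> (forall u' v', bilin (fun u v => h u v u' v')) ->
  bilin (fun x y => tens_lift (fun u v => tens_lift (h u v) y) x).
Proof.
move=> h1 h2.
have hb (y : tensor U' V') : bilin (fun u v => tens_lift (h u v) y).
  by split=> [v|u] a x x'; rewrite /tens_lift scaler_sumr -big_split /=;
    apply: eq_bigr => p _; rewrite ?(h2 _ _).1 ?(h2 _ _).2.
split=> [y|x]; first exact: tens_lift_linear (hb y).
move=> a y y'; rewrite {1 3 5}/tens_lift scaler_sumr -big_split /=.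
by apply: eq_bigr => p _; rewrite (tens_lift_linear (h1 _ _)).
Qed.

Lemma tens_lift2_pure U V U' V' M (h : U -> V -> U' -> V' -> M) u v u' v' :
  (forall u v, bilin (h u v)) -> (forall u' v', bilin (fun u v => h u v u' v')) ->
  tens_lift (fun u v => tens_lift (h u v) (u' ⊗ v')) (u ⊗ v) = h u v u' v'.
Proof.
move=> h1 h2; rewrite -[RHS](tens_lift_pure (h2 u' v')).
by apply: eq_tens_lift => w z; rewrite (tens_lift_pure (h1 w z)).
Qed.

Section Cross.
Variables (V W P Q S : lmodType k) (m : P -> Q -> S).
Hypothesis m_bilin : bilin m.

Let h v a w b : tensor (tensor V W) S := (v ⊗ w) ⊗ m a b.

Let h1 v a : bilin (h v a).
Proof.
split=> [b|w] c x y; rewrite /h ?m_bilin.2 ?(pure_bilin _ _).2 //.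
by rewrite (pure_bilin _ _).1.
Qed.

Let h2 w b : bilin (fun v a => h v a w b).
Proof.
split=> [a|v] c x y; rewrite /h ?m_bilin.1 ?(pure_bilin _ _).2 //.
by rewrite !(pure_bilin _ _).1.
Qed.

Lemma tens_cross_bilin : bilin (@tens_cross k V W P Q S m).
Proof. exact: tens_lift2_bilin h1 h2. Qed.

Lemma tens_cross_pure (v : V) (a : P) (w : W) (b : Q) :
  tens_cross m (v ⊗ a) (w ⊗ b) = (v ⊗ w) ⊗ m a b.
Proof. exact: (tens_lift2_pure v a w b h1 h2). Qed.

End Cross.

Section Mul.
Variable A : algType k.

Lemma mul_bilin : bilin (fun a b : A => a * b).
Proof.
by split=> [b|a] c x y; rewrite ?mulrDl ?mulrDr -?scalerAl -?scalerAr.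
Qed.

Let h (a b c d : A) := (a * c) ⊗ (b * d).

Let h1 a b : bilin (h a b).
Proof.
split=> [d|c] z x y; rewrite /h mul_bilin.2;
by rewrite ?(pure_bilin _ _).1 ?(pure_bilin _ _).2.
Qed.

Let h2 c d : bilin (fun a b => h a b c d).
Proof.
split=> [b|a] z x y; rewrite /h mul_bilin.1;
by rewrite ?(pure_bilin _ _).1 ?(pure_bilin _ _).2.
Qed.

Lemma tens_mul_bilin : bilin (@tens_mul k A).
Proof. exact: tens_lift2_bilin h1 h2. Qed.

Lemma tens_mul_pure (a b c d : A) :
  tens_mul (a ⊗ b) (c ⊗ d) = (a * c) ⊗ (b * d).
Proof. exact: (tens_lift2_pure a b c d h1 h2). Qed.

End Mul.

End TensorMaps.

Record comodule (k : fieldType) (C : coalgType k) := Comodule {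
  comod_car :> lmodType k;
  coact : {linear comod_car -> tensor comod_car C};
  coactA : forall v,
    tens_assoc (tens_map coact idfun (coact v)) = tens_map idfun comul (coact v);
  coact_counit : forall v, tens_lift (fun (w : comod_car) (c : C) => counit c *: w) (coact v) = v
}.


Arguments coact {k C c}.

Lemma counit_bilin (k : fieldType) (C : coalgType k) (M : lmodType k) :
  bilin (fun (w : M) (c : C) => counit c *: w).
Proof.
split=> [c|w] a x y; last by rewrite linearP scalerDl scalerA.
by rewrite scalerDr !scalerA mulrC.
Qed.

Section Res.
Variables (k : fieldType) (A B : hopfType k) (f : hopfMor A B) (V : comodule A).

Definition res_coact : V -> tensor V B := tens_map idfun f \o coact.

HB.instance Definition _ := GRing.Linear.on res_coact.

Lemma res_coactA v :
  tens_assoc (tens_map res_coact idfun (res_coact v))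
  = tens_map idfun comul (res_coact v).
Proof.
rewrite /res_coact /= !tens_map_comp.
rewrite (eq_tens_map (f' := tens_map idfun f \o coact) (g' := f \o idfun)) //.
rewrite -(tens_map_comp coact idfun (tens_map idfun f) f) tens_assoc_map coactA tens_map_comp.
by apply: eq_tens_map => // c /=; rewrite hopf_comul.
Qed.

Lemma res_coact_counit v :
  tens_lift (fun (w : V) (c : B) => counit c *: w) (res_coact v) = v.
Proof.
rewrite /res_coact /= (tens_lift_map _ _ (counit_bilin _ _)) -[RHS]coact_counit.
by apply: eq_tens_lift => w c /=; rewrite hopf_counit.
Qed.

Definition res_comod : comodule B := Comodule res_coactA res_coact_counit.

End Res.

Section TensComod.
Variables (k : fieldType) (A : hopfType k) (V W : comodule A).

Let mulA (a b : A) : A := a * b.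

(* v ⊗ w |-> (v_0 ⊗ w_0) ⊗ v_1 w_1 *)
Definition tens_coact : tensor V W -> tensor (tensor V W) A :=
  tens_lift (fun v w => tens_cross (fun a b : A => a * b) (coact v) (coact w)).

Let cross_bilin : bilin (@tens_cross k V W A A A mulA).
Proof. exact: tens_cross_bilin (mul_bilin A). Qed.

Let cross_pure (v : V) (a : A) (w : W) (b : A) :
  tens_cross mulA (v ⊗ a) (w ⊗ b) = (v ⊗ w) ⊗ (a * b).
Proof. exact: tens_cross_pure (mul_bilin A) v a w b. Qed.

Let coact_bilin : bilin (fun (v : V) (w : W) =>
  tens_cross mulA (coact v) (coact w)).
Proof. by apply: (bilin_comp cross_bilin) => a x y; rewrite linearP. Qed.

Lemma tens_coact_linear : linear tens_coact.
Proof. exact: tens_lift_linear coact_bilin. Qed.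

HB.instance Definition _ :=
  GRing.isLinear.Build k (tensor V W) (tensor (tensor V W) A) *:%R tens_coact
    tens_coact_linear.

Lemma tens_coact_pure (v : V) (w : W) :
  tens_coact (v ⊗ w) = tens_cross (fun a b : A => a * b) (coact v) (coact w).
Proof. exact: tens_lift_pure coact_bilin v w. Qed.

Lemma tens_coactA x :
  tens_assoc (tens_map tens_coact idfun (tens_coact x))
  = tens_map idfun comul (tens_coact x).
Proof.
pose cross2 := @tens_cross k V W _ _ _ (@tens_mul k A).
have cross2b : bilin cross2 := tens_cross_bilin _ _ (tens_mul_bilin A).
apply: (tens_ext
  (f := @tens_assoc k _ _ _ \o tens_map tens_coact idfun \o tens_coact)
  (g := tens_map idfun comul \o tens_coact)) => [||v w /=].
- exact: linearP.
- exact: linearP.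
rewrite tens_coact_pure.
transitivity (cross2 (tens_map idfun comul (coact v))
                     (tens_map idfun comul (coact w))); last first.
  apply: (bilin_ext
    (f := fun x y => cross2 (tens_map idfun comul x) (tens_map idfun comul y))
    (g := fun x y => tens_map idfun comul (tens_cross mulA x y))) => /=.
  - by apply: (bilin_comp cross2b); apply: linearP.
  - by apply: (linear_bilin cross_bilin); apply: linearP.
  move=> {}v a {}w b; rewrite cross_pure !tens_map_pure /= comulM.
  exact: tens_cross_pure (tens_mul_bilin A) _ _ _ _.
rewrite -!coactA.
apply: (bilin_ext
  (f := fun x y => tens_assoc (tens_map tens_coact idfun (tens_cross mulA x y)))
  (g := fun x y => cross2 (tens_assoc (tens_map coact idfun x))
                          (tens_assoc (tens_map coact idfun y)))) => /=.
- apply: (linear_bilin (l := @tens_assoc k _ _ _ \o tens_map tens_coact idfun)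
    cross_bilin); exact: linearP.
- apply: (bilin_comp (f := @tens_assoc k _ _ _ \o tens_map coact idfun)
    (g := @tens_assoc k _ _ _ \o tens_map coact idfun) cross2b); exact: linearP.
move=> {}v a {}w b; rewrite cross_pure !tens_map_pure /= tens_coact_pure.
have pl (M N : lmodType k) (n : N) : linear (fun x : M => x ⊗ n) by exact: (pure_bilin M N).1.
apply: (bilin_ext
  (f := fun x y => tens_assoc (tens_cross mulA x y ⊗ (a * b)))
  (g := fun x y => cross2 (tens_assoc (x ⊗ a)) (tens_assoc (y ⊗ b)))) => /=.
- apply: (linear_bilin (l := fun z => tens_assoc (z ⊗ (a * b))) cross_bilin).
  by move=> c x1 x2; rewrite pl linearP.
- apply: (bilin_comp (f := fun z => tens_assoc (z ⊗ a))
    (g := fun z => tens_assoc (z ⊗ b)) cross2b) => c x1 x2;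
  by rewrite pl linearP.
move=> {}v a' {}w b'; rewrite cross_pure !tens_assoc_pure.
rewrite /cross2 (tens_cross_pure (tens_mul_bilin A)).
by rewrite tens_mul_pure.
Qed.

Lemma tens_coact_counit x :
  tens_lift (fun (w : tensor V W : lmodType k) (c : A) => counit c *: w) (tens_coact x) = x.
Proof.
have el (M : lmodType k) :
    linear (tens_lift (fun (w : M) (c : A) => counit c *: w)).
  exact: tens_lift_linear (counit_bilin A M).
apply: (tens_ext (f := fun x => tens_lift
  (fun (w : tensor V W : lmodType k) (c : A) => counit c *: w) (tens_coact x)) (g := idfun)).
- by move=> a y z; rewrite linearP el.
- by [].
move=> v w; rewrite tens_coact_pure /= -{2}[v]coact_counit -{2}[w]coact_counit.
apply: (bilin_ext
  (f := fun x y => tens_lift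
    (fun (w : tensor V W : lmodType k) (c : A) => counit c *: w)
    (tens_cross mulA x y))
  (g := fun x y => tens_lift (fun (w : V) (c : A) => counit c *: w) x
               ⊗ tens_lift (fun (w : W) (c : A) => counit c *: w) y)).
- exact: (linear_bilin cross_bilin (el _)).
- exact: (bilin_comp (pure_bilin _ _) (el _) (el _)).
move=> {}v a {}w b; rewrite cross_pure !(tens_lift_pure (counit_bilin _ _)).
have pZl (c : k) (u : V) (u' : W) : (c *: u) ⊗ u' = c *: (u ⊗ u').
  by have := (pure_bilin V W).1 u' c u 0; rewrite !addr0 tens_pure0 addr0.
have pZr (c : k) (u : V) (u' : W) : u ⊗ (c *: u') = c *: (u ⊗ u').
  by rewrite -pZl; apply/tens_classP/tens_sym/tens_relZ.
by rewrite pZl pZr scalerA counitM.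
Qed.

Definition tens_comod : comodule A := Comodule tens_coactA tens_coact_counit.

End TensComod.

Section Subspaces.
Variable k : fieldType.
Implicit Types V W : lmodType k.

Definition subspace V (P : V -> Prop) : Prop :=
  P 0 /\ forall a x y, P x -> P y -> P (a *: x + y).

(* x lies in the image of P ⊗ Q in V ⊗ W. *)
Definition tens_in V W (P : V -> Prop) (Q : W -> Prop) (x : tensor V W) : Prop :=
  exists s : seq (V * W),
    (forall p, p \in s -> P p.1 /\ Q p.2) /\ x = \sum_(p <- s) p.1 ⊗ p.2.

Variable C : coalgType k.
Implicit Types D E : C -> Prop.

Definition subcoalgebra D : Prop :=
  subspace D /\ forall d, D d -> tens_in D D (comul d).

Definition simple_subcoalgebra D : Prop :=
  subcoalgebra D /\ (exists2 d, D d & d != 0) /\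
  forall E, subcoalgebra E -> (forall x, E x -> D x) ->
    (forall x, E x -> x = 0) \/ (forall x, D x -> E x).

(* C is the sum of its simple subcoalgebras (this sum is always direct). *)
Definition cosemisimple : Prop :=
  forall c : C, exists s : seq C,
    (forall x, x \in s -> exists2 D, simple_subcoalgebra D & D x)
    /\ c = \sum_(x <- s) x.

Implicit Types M N : comodule C.

Definition subcomodule M (P : M -> Prop) : Prop :=
  subspace P /\ forall v, P v -> tens_in P (fun _ : C => True) (coact v).

Definition simple_comodule M : Prop :=
  (exists v : M, v != 0) /\
  forall P : M -> Prop, subcomodule P ->
    (forall v, P v -> v = 0) \/ (forall v, P v).

Definition colinear M N (f : {linear M -> N}) : Prop :=
  forall v, coact (f v) = tens_map f idfun (coact v).

Definition comod_iso M N : Prop :=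
  exists2 f : {linear M -> N}, colinear f & bijective f.

Definition hom_nonzero M N : Prop :=
  exists2 f : {linear M -> N}, colinear f & exists v, f v != 0.

(* M is a direct sum of n copies of N, with inclusions f i. *)
Definition sum_of_copies M N : Prop :=
  exists n (f : 'I_n -> {linear N -> M}),
    (forall i, colinear (f i)) /\
    bijective (fun w : {ffun 'I_n -> N} => \sum_i f i (w i)).

(* (V i)_i lists every simple comodule exactly once up to isomorphism, so that
   I is the set of isomorphism classes of simple comodules. *)
Definition simple_classes (I : Type) (V : I -> comodule C) : Prop :=
  [/\ forall i, simple_comodule (V i),
      forall i j, comod_iso (V i) (V j) -> i = j
    & forall M, simple_comodule M -> exists i, comod_iso M (V i)].

End Subspaces.

(* In the set J of classes of simple comodules listed by W, l is the product of
   i and j for the tensor product. *)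
Definition tensor_class (k : fieldType) (A : hopfType k) (J : Type)
    (W : J -> comodule A) (i j l : J) : Prop :=
  comod_iso (W l) (tens_comod (W i) (W j)).

Section QuantumSubgroups.
Variable k : fieldType.
Implicit Types A B Q Z R : hopfType k.

Definition hopf_surjective A B (f : hopfMor A B) : Prop :=
  forall y, exists x, f x = y.

(* pi(x_1) ⊗ x_2 = pi(x_2) ⊗ x_1 *)
Definition hopf_central A Q (pi : hopfMor A Q) : Prop :=
  forall x, tens_map pi idfun (comul x)
            = tens_map pi idfun (tens_swap (comul x)).

Definition is_center A Z (piZ : hopfMor A Z) : Prop :=
  [/\ hopf_surjective piZ, hopf_central piZ
    & forall Q (q : hopfMor A Q), hopf_surjective q -> hopf_central q ->
        exists r : hopfMor Z Q, forall x, q x = r (piZ x)].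

Definition is_intersection A Z B R (piZ : hopfMor A Z) (piH : hopfMor A B)
    (rho : hopfMor A R) : Prop :=
  hopf_surjective rho /\
  forall x, rho x = 0 <-> exists y z, [/\ piZ y = 0, piH z = 0 & x = y + z].

End QuantumSubgroups.

(* (true, x) stands for the generator x and (false, x) for its inverse. *)
Definition word (X : Type) := seq (bool * X).

Section Presentation.
Variables (X : choiceType) (rels : word X -> word X -> Prop).
Implicit Types s t : word X.

Inductive word_eq : word X -> word X -> Prop :=
| word_eq_rel s t : rels s t -> word_eq s t
| word_eq_cancel b x : word_eq [:: (b, x); (~~ b, x)] [::]
| word_eq_refl s : word_eq s s
| word_eq_sym s t : word_eq s t -> word_eq t s
| word_eq_trans t s r : word_eq s t -> word_eq t r -> word_eq s r
| word_eq_cat s s' t t' :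
    word_eq s s' -> word_eq t t' -> word_eq (s ++ t) (s' ++ t').

Definition word_eqb s t : bool := `[< word_eq s t >].

Lemma word_eqb_refl : reflexive word_eqb.
Proof. by move=> s; apply/asboolP; apply: word_eq_refl. Qed.

Lemma word_eqb_sym : symmetric word_eqb.
Proof. by move=> s t; apply/asboolP/asboolP => /word_eq_sym. Qed.

Lemma word_eqb_trans : transitive word_eqb.
Proof.
by move=> t s r /asboolP st /asboolP tr; apply/asboolP; apply: word_eq_trans tr.
Qed.

Canonical word_equiv := EquivRel word_eqb word_eqb_refl word_eqb_sym word_eqb_trans.

Definition presented : Type := {eq_quot word_equiv}.
HB.instance Definition _ := Choice.on presented.
HB.instance Definition _ := Quotient.on presented.
HB.instance Definition _ := EqQuotient.on presented.

Definition word_class s : presented := \pi_presented s.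

Lemma word_classP s t : word_class s = word_class t <-> word_eq s t.
Proof.
rewrite /word_class; split.
  by move=> /eqP; rewrite eqmodE => /asboolP.
by move=> st; apply/eqP; rewrite eqmodE; apply/asboolP.
Qed.

Lemma word_classK g : word_class (repr g) = g.
Proof. exact: reprK. Qed.

Definition word_inv s : word X := rev [seq (~~ p.1, p.2) | p <- s].

Definition pone : presented := word_class [::].
Definition pmul (g h : presented) : presented := word_class (repr g ++ repr h).
Definition pinv (g : presented) : presented := word_class (word_inv (repr g)).

Lemma word_eq_repr s : word_eq (repr (word_class s)) s.
Proof. by apply/word_classP; rewrite word_classK. Qed.

Lemma pmulE s t : pmul (word_class s) (word_class t) = word_class (s ++ t).
Proof. by apply/word_classP/word_eq_cat; apply: word_eq_repr. Qed.

Lemma word_inv_cons b x s :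
  word_inv ((b, x) :: s) = word_inv s ++ [:: (~~ b, x)].
Proof. by rewrite /word_inv /= rev_cons cats1. Qed.

Lemma word_invK : involutive word_inv.
Proof.
move=> s; rewrite /word_inv map_rev revK -map_comp -[RHS]map_id.
by apply: eq_map => -[b x]; rewrite /= negbK.
Qed.

Lemma word_eq_invr s : word_eq (s ++ word_inv s) [::].
Proof.
elim: s => [|[b x] s IH]; first exact: word_eq_refl.
rewrite word_inv_cons -cat1s -!catA (catA s).
apply: word_eq_trans (word_eq_cancel b x).
apply: (word_eq_cat (word_eq_refl [:: (b, x)])).
exact: (word_eq_cat IH (word_eq_refl [:: (~~ b, x)])).
Qed.

Lemma pmulA : associative pmul.
Proof.
move=> g h l; rewrite -[g]word_classK -[h]word_classK -[l]word_classK.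
by rewrite !pmulE catA.
Qed.

Lemma pmul1g : left_id pone pmul.
Proof. by move=> g; rewrite -[g]word_classK pmulE. Qed.

Lemma pmulg1 : right_id pone pmul.
Proof. by move=> g; rewrite -[g]word_classK pmulE cats0. Qed.

Lemma pmulgV : right_inverse pone pinv pmul.
Proof.
move=> g; rewrite /pinv -{1}[g]word_classK pmulE.
exact/word_classP/word_eq_invr.
Qed.

Lemma pmulVg : left_inverse pone pinv pmul.
Proof.
move=> g; rewrite /pinv -{2}[g]word_classK pmulE; apply/word_classP.
by rewrite -{2}[repr g]word_invK; apply: word_eq_invr.
Qed.

HB.instance Definition _ :=
  isGroup.Build presented pmulA pmul1g pmulg1 pmulVg pmulgV.

Definition pres_gen (x : X) : presented := word_class [:: (true, x)].

End Presentation.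

Section ChainGroup.
Variables (k : fieldType) (A B : hopfType k) (piH : hopfMor A B).
Variables (I : choiceType) (V : I -> comodule A).

(* g_u = g_v g_w whenever hom_H (V u, V v ⊗ V w) <> 0 *)
Definition chain_rel (s t : word I) : Prop := exists u v w,
  [/\ hom_nonzero (res_comod piH (V u)) (res_comod piH (tens_comod (V v) (V w))),
      s = [:: (true, u)] & t = [:: (true, v); (true, w)]].

Definition chain_group := presented chain_rel.
HB.instance Definition _ := Group.on chain_group.

Definition chain_gen (i : I) : chain_group := pres_gen chain_rel i.

End ChainGroup.

(* Main.v *)
Require Import Defs.
From HB Require Import structures.
From mathcomp Require Import all_boot all_order all_algebra.
From mathcomp Require Import boolp.
From mathcomp Require classical_sets freeg.

(** Write G for the chain group and g_i for the generator of a simple comodule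
    V_i of A.  Two maps in opposite directions are constructed and compared.

    From grouplikes to degrees.  The coefficient spaces of the V_i span A
    ([coefs_of_total]), and products of coefficients of V_i and V_j are
    coefficients of those V_m that map nontrivially to V_i ⊗ V_j
    ([coefs_decomposition]); so A is graded by G, with the coefficients of V_i
    in degree g_i.  The grading amounts to a central surjective Hopf morphism
    q : A -> k[G], q c = ε(c) g_i for c a coefficient of V_i.  By the universal
    property of the center, q kills ker piZ.  It also kills ker piH, because the
    same formula is consistent on B: the images in B of coefficient spaces of
    different degrees are independent ([exists_degree_functional]).  Hence q
    factors through R ([intersection_degree_map]).

    From degrees to grouplikes.  R is a central quotient of A, so Schur's lemma
    makes the coaction of R on V_i scalar, v |-> v ⊗ r_i with r_i grouplike
    ([central_scalar]).  R is also a quotient of B, so a nonzero B-colinear map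
    from V_u to V_v ⊗ V_w forces r_u = r_v r_w ([central_mul]): thus g_i |-> r_i
    is well defined and multiplicative.  The degree map sends r_i back to g_i,
    which gives injectivity; and since the r_i span R, every simple R-comodule
    is the line attached to some r_i ([simple_grouplike]), which gives
    surjectivity.

    Both independence statements, in A and in B, come from the same argument.
    A cosemisimple Hopf algebra has an invariant integral λ with λ(1) = 1
    ([exists_integral]).  If there is no nonzero colinear map X -> Y, averaging
    rank one maps shows that λ(d S(c)) = 0 for coefficients c of X and d of Y
    ([orthogonality]).  Two subcoalgebras orthogonal in this sense meet in 0: on
    an element y of both, ε(y) = λ(y_1 S(y_2)) = 0 ([orthogonal_disjoint]).  This
    replaces the decomposition of comodules into simple ones: the only
    structural fact about simple comodules that is needed is that every nonzero
    comodule contains a finite-dimensional simple one.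

    Spaces may have infinite dimension, so tensors are studied through their
    slices by linear functionals; there are enough functionals by Zorn's lemma
    ([separation]). *)

Set Implicit Arguments.
Unset Strict Implicit.
Unset Printing Implicit Defensive.

Import GRing.Theory.
Local Open Scope ring_scope.

(** * Subspaces and linear functionals *)

Section Subspaces.
Variable k : fieldType.
Implicit Types U V W : lmodType k.

Definition dual V := {linear V -> k^o}.

Lemma bundle_linear U V (f : U -> V) : linear f ->
  exists g : {linear U -> V}, g =1 f.
Proof.
move=> fl; pose m := GRing.isLinear.Build k U V *:%R f fl.
by pose g : {linear U -> V} := HB.pack f m; exists g.
Qed.

Section SubspaceTheory.
Variables (V : lmodType k) (P : V -> Prop).
Hypothesis sP : subspace P.

Lemma subspaceD x y : P x -> P y -> P (x + y).
Proof. by move=> Px Py; rewrite -[x]scale1r; apply: sP.2. Qed.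

Lemma subspaceZ a x : P x -> P (a *: x).
Proof. by move=> Px; rewrite -[_ *: _]addr0; apply: sP.2 => //; apply: sP.1. Qed.

Lemma subspaceB x y : P x -> P y -> P (x - y).
Proof. by move=> Px Py; rewrite -scaleN1r; apply: subspaceD => //; apply: subspaceZ. Qed.

Lemma subspace_sum (I : Type) (r : seq I) (F : I -> V) :
  (forall i, P (F i)) -> P (\sum_(i <- r) F i).
Proof.
move=> PF; elim: r => [|i r IH]; first by rewrite big_nil; apply: sP.1.
by rewrite big_cons; apply: subspaceD.
Qed.

Lemma subspace_sum_seq (I : eqType) (r : seq I) (F : I -> V) :
  (forall i, i \in r -> P (F i)) -> P (\sum_(i <- r) F i).
Proof.
move=> PF; rewrite big_seq.
elim/big_ind: _ => [|x y|i /PF //]; [exact: sP.1|exact: subspaceD].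
Qed.

End SubspaceTheory.

Lemma subspace_true V : subspace (fun _ : V => True).
Proof. by []. Qed.

Lemma subspace_zero V : subspace (fun x : V => x = 0).
Proof. by split=> // a x y -> ->; rewrite scaler0 addr0. Qed.

Lemma subspaceI V (P Q : V -> Prop) :
  subspace P -> subspace Q -> subspace (fun x => P x /\ Q x).
Proof.
move=> sP sQ; split=> [|a x y [Px Qx] [Py Qy]]; first by split; [apply: sP.1|apply: sQ.1].
by split; [apply: sP.2|apply: sQ.2].
Qed.

Lemma subspace_preim V W (f : {linear V -> W}) (P : W -> Prop) :
  subspace P -> subspace (fun x => P (f x)).
Proof.
move=> sP; split=> [|a x y Px Py]; first by rewrite linear0; apply: sP.1.
by rewrite linearP; apply: sP.2.
Qed.

Lemma subspace_ker V W (f : {linear V -> W}) : subspace (fun x => f x = 0).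
Proof. exact: subspace_preim (subspace_zero W). Qed.

(** Defined by its elimination rule: a property of the span is proved by showing
    that it is closed under linear combinations and holds on the generators. *)
Definition linspan V (S : V -> Prop) (x : V) : Prop :=
  forall P, subspace P -> (forall y, S y -> P y) -> P x.

Lemma linspan_subspace V (S : V -> Prop) : subspace (linspan S).
Proof.
split=> [P sP _|a x y Sx Sy P sP SP]; first exact: sP.1.
by apply: sP.2; [apply: Sx|apply: Sy].
Qed.

Lemma linspan_mem V (S : V -> Prop) x : S x -> linspan S x.
Proof. by move=> Sx P _; apply. Qed.

Lemma linspan_sub V (S T : V -> Prop) :
  (forall x, S x -> T x) -> forall x, linspan S x -> linspan T x.
Proof.
move=> ST x Sx; apply: (Sx _ (linspan_subspace T)) => y Sy.
by apply: linspan_mem; apply: ST.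
Qed.

(** A subspace that is maximal among those containing P and avoiding v has
    codimension one, and the functional is the coordinate along v. *)
Lemma separation V (P : V -> Prop) v : subspace P -> ~ P v ->
  exists f : dual V, (forall x, P x -> f x = 0) /\ f v = 1.
Proof.
move=> sP nPv.
(* The set ordered by inclusion consists of the X with X ∪ P a subspace; adding
   P here lets the empty chain have an upper bound. *)
pose U (X : V -> Prop) x := X x \/ P x.
pose F (X : V -> Prop) := subspace (U X) /\ ~ X v.
have [|A [[sA nAv] maxA]] := @classical_sets.Zorn_bigcup V F.
  move=> G GF Gtot; split; last by case=> X GX; case: (GF _ GX).
  have Gsub x y : U (classical_sets.bigcup G id) x -> U (classical_sets.bigcup G id) y ->
      exists X, [/\ subspace (U X), forall z, U X z -> U (classical_sets.bigcup G id) z,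
                    U X x & U X y].
    case=> [[X GX Xx]|Px] [[Y GY Yy]|Py].
    - case: (Gtot _ _ GX GY) => sub.
        exists Y; split; [exact: (GF _ GY).1| | by left; apply: sub | by left].
        by move=> z [Yz|Pz]; [left; exists Y|right].
      exists X; split; [exact: (GF _ GX).1| | by left | by left; apply: sub].
      by move=> z [Xz|Pz]; [left; exists X|right].
    - exists X; split; [exact: (GF _ GX).1| | by left | by right].
      by move=> z [Xz|Pz]; [left; exists X|right].
    - exists Y; split; [exact: (GF _ GY).1| | by right | by left].
      by move=> z [Xz|Pz]; [left; exists Y|right].
    exists P; split; [|by move=> z [] ; right|by right|by right].
    by rewrite /U; split=> [|a z t []Pz []Pt]; left; try exact: sP.1; exact: sP.2.
  split=> [|a x y /Gsub h /h [X [sX UX Xx Xy]]]; first by right; exact: sP.1.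
  by apply: UX; apply: sX.2.
pose Q := U A.
have nQv : ~ Q v by case.
have QP x : P x -> Q x by right.
have coefE x : exists c, Q (x - c *: v).
  have [Ax|nAx] := pselect (A x).
    by exists 0; rewrite scale0r subr0; left.
  pose B y := exists a, Q (y - a *: x).
  have QB y : Q y -> B y by exists 0; rewrite scale0r subr0.
  have sB : subspace B.
    split=> [|a y z [b Qy] [c Qz]]; first exact/QB/sA.1.
    exists (a * b + c); rewrite scalerDl -scalerA opprD addrACA -scalerBr.
    exact: sA.2.
  have [[a Qva]|nBv] := pselect (B v).
    have a0 : a != 0.
      by apply/eqP => a0; apply: nQv; rewrite -[v]subr0 -(scale0r x) -a0.
    exists a^-1; have -> : x - a^-1 *: v = (- a^-1) *: (v - a *: x).
      by rewrite scalerBr scalerA mulNr mulVf // !scaleNr scale1r opprK addrC.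
    exact: subspaceZ.
  case: (maxA B); last split=> //.
    split=> [y Ay|BA]; first by apply: QB; left.
    by apply: nAx; apply: BA; exists 1; rewrite scale1r subrr; apply: sA.1.
  suff -> : U B = B by [].
  by apply/funext => y; apply/propext; split=> [[//|/QP/QB]|]; [|left].
have coef_uniq x c d : Q (x - c *: v) -> Q (x - d *: v) -> c = d.
  move=> Qc Qd; apply/eqP/negPn/negP => cd; apply: nQv.
  have -> : v = (d - c)^-1 *: ((x - c *: v) - (x - d *: v)).
    rewrite opprB [in X in _ *: X]addrC addrA subrK.
    by rewrite -scalerBl scalerA mulVf ?scale1r // subr_eq0 eq_sym.
  by apply: subspaceZ => //; apply: subspaceB.
have [f0 f0E] := choice coefE.
have f0l : linear (f0 : V -> k^o).
  move=> a x y; apply: (coef_uniq (a *: x + y)) => //.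
  have -> : a *: x + y - (a *: (f0 x : k^o) + f0 y) *: v
     = a *: (x - f0 x *: v) + (y - f0 y *: v).
    by rewrite scalerDl scalerBr addrACA -opprD scalerA.
  by apply: sA.2; apply: f0E.
have [f fE] := bundle_linear f0l; exists f; split=> [x Px|]; rewrite fE.
  by apply: (coef_uniq x) => //; rewrite scale0r subr0; apply: QP.
by apply: (coef_uniq v) => //; rewrite scale1r subrr; apply: sA.1.
Qed.

Lemma separating V (x : V) : (forall f : dual V, f x = 0) -> x = 0.
Proof.
move=> fx; apply: contrapT => nx.
have [f [_ f1]] := separation (subspace_zero V) nx.
by move: (fx f); rewrite f1 => /eqP; rewrite oner_eq0.
Qed.

Lemma subspace_dualP V (P : V -> Prop) x : subspace P ->
  (forall f : dual V, (forall y, P y -> f y = 0) -> f x = 0) -> P x.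
Proof.
move=> sP h; apply: contrapT => nx.
have [f [fP f1]] := separation sP nx.
by move: (h f fP); rewrite f1 => /eqP; rewrite oner_eq0.
Qed.

End Subspaces.

Lemma linspan_cone_sum (k : fieldType) (V : lmodType k) (S : V -> Prop) :
  (forall a x, S x -> S (a *: x)) -> forall x, linspan S x ->
  exists s : seq V, (forall y, y \in s -> S y) /\ x = \sum_(y <- s) y.
Proof.
move=> SZ x xS.
pose P x := exists s : seq V, (forall y, y \in s -> S y) /\ x = \sum_(y <- s) y.
apply: (xS P) => {x xS}; last first.
  move=> y Sy; exists [:: y]; rewrite big_seq1; split=> // z.
  by rewrite inE => /eqP ->.
split=> [|a _ _ [s [sS ->]] [t [tS ->]]]; first by exists [::]; rewrite big_nil.
exists ([seq a *: y | y <- s] ++ t); split; last first.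
  by rewrite big_cat big_map scaler_sumr.
by move=> y; rewrite mem_cat => /orP[/mapP[z /sS Sz ->]|/tS]; first exact: SZ.
Qed.

(** Pick p0 in P with f p0 = 1; it lies outside of N plus the kernel of f on P,
    since a decomposition p0 = y + z would put z = p0 - y in both P and N with
    f z = 1.  The functional separating p0 from that space is the one wanted. *)
Lemma extend_functional (k : fieldType) (V : lmodType k) (P N : V -> Prop) (f : dual V) :
  subspace P -> subspace N -> (forall x, P x -> N x -> f x = 0) ->
  exists h : dual V, (forall x, P x -> h x = f x) /\ (forall x, N x -> h x = 0).
Proof.
move=> sP sN PN.
have [[p [Pp fp]]|f0] := pselect (exists p, P p /\ f p <> 0); last first.
  have [|h hE] := @bundle_linear k V k^o (fun _ => 0).
    by move=> a x y; rewrite scaler0 addr0.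
  exists h; split=> x Px; rewrite hE //.
  by apply: contrapT => /nesym fx; apply: f0; exists x.
pose p0 := (f p : k)^-1 *: p.
have Pp0 : P p0 by apply: subspaceZ.
have fp0 : f p0 = 1.
  by rewrite linearZ_LR /= /GRing.scale /= mulVf //; apply/eqP.
pose K x := exists y z, [/\ P y, f y = 0, N z & x = y + z].
have sK : subspace K.
  split=> [|a _ _ [y [z [Py fy Nz ->]]] [y' [z' [Py' fy' Nz' ->]]]].
    by exists 0, 0; split; [exact: sP.1|exact: linear0|exact: sN.1|rewrite addr0].
  exists (a *: y + y'), (a *: z + z'); split; [exact: sP.2| |exact: sN.2|].
    by rewrite linearP fy fy' scaler0 addr0.
  by rewrite scalerDr addrACA.
have [|h [hK h1]] := separation (v := p0) sK.
  move=> [y [z [Py fy Nz p0E]]].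
  have zE : z = p0 - y by rewrite p0E addrC addKr.
  have : f z = 0 by apply: PN => //; rewrite zE; apply: subspaceB.
  by rewrite zE linearB fp0 fy subr0 => /eqP; rewrite oner_eq0.
exists h; split=> x; last first.
  by move=> Nx; apply: hK; exists 0, x; split; [exact: sP.1|exact: linear0| |rewrite add0r].
move=> Px; have : h (x - (f x : k) *: p0) = 0.
  apply: hK; exists (x - (f x : k) *: p0), 0; split; last by rewrite addr0.
  - by apply: subspaceB => //; apply: subspaceZ.
  - by rewrite linearB linearZ_LR /= fp0 /GRing.scale /= mulr1 subrr.
  - exact: sN.1.
by rewrite linearB linearZ_LR /= h1 /GRing.scale /= mulr1 => /subr0_eq.
Qed.

(** The homomorphism theorem, by choosing preimages. *)
Lemma factor_through (k : fieldType) (U V M : lmodType k) (f : {linear U -> V})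
    (g : {linear U -> M}) :
  (forall y, exists x, f x = y) -> (forall x, f x = 0 -> g x = 0) ->
  exists h : {linear V -> M}, forall x, g x = h (f x).
Proof.
move=> fsurj fg; have [s sK] := choice fsurj.
have gs x y : f x = f y -> g x = g y.
  by move=> fxy; apply/subr0_eq; rewrite -linearB fg // linearB fxy subrr.
have [h hE] : exists h : {linear V -> M}, h =1 g \o s.
  by apply: bundle_linear => a x y /=; rewrite -linearP; apply: gs; rewrite linearP !sK.
by exists h => x; rewrite hE; apply: gs; rewrite sK.
Qed.

(** * Slices of tensors *)

Section Slices.
Variable k : fieldType.
Implicit Types U V W M : lmodType k.

Lemma pureDl U V (u u' : U) (v : V) : (u + u') ⊗ v = u ⊗ v + u' ⊗ v.
Proof. by rewrite -[u]scale1r (pure_bilin _ _).1 !scale1r. Qed.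

Lemma pureDr U V (u : U) (v v' : V) : u ⊗ (v + v') = u ⊗ v + u ⊗ v'.
Proof. by rewrite -[v]scale1r (pure_bilin _ _).2 !scale1r. Qed.

Lemma pure0l U V (v : V) : (0 : U) ⊗ v = 0.
Proof. by apply: (@addrI _ (0 ⊗ v)); rewrite -pureDl !addr0. Qed.

Lemma pure0r U V (u : U) : u ⊗ (0 : V) = 0.
Proof. by apply: (@addrI _ (u ⊗ 0)); rewrite -pureDr !addr0. Qed.

Lemma pureZl U V a (u : U) (v : V) : (a *: u) ⊗ v = a *: (u ⊗ v).
Proof. by rewrite -[a *: u]addr0 (pure_bilin _ _).1 pure0l addr0. Qed.

Lemma pureZr U V a (u : U) (v : V) : u ⊗ (a *: v) = a *: (u ⊗ v).
Proof. by rewrite -[a *: v]addr0 (pure_bilin _ _).2 pure0r addr0. Qed.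

Lemma pureZlr U V a (u : U) (v : V) : (a *: u) ⊗ v = u ⊗ (a *: v).
Proof. by rewrite pureZl pureZr. Qed.

Lemma pureBl U V (u u' : U) (v : V) : (u - u') ⊗ v = u ⊗ v - u' ⊗ v.
Proof. by rewrite pureDl -scaleN1r pureZl scaleN1r. Qed.

Lemma pureBr U V (u : U) (v v' : V) : u ⊗ (v - v') = u ⊗ v - u ⊗ v'.
Proof. by rewrite pureDr -scaleN1r pureZr scaleN1r. Qed.

Lemma pure_suml U V (I : Type) (r : seq I) (F : I -> U) (v : V) :
  (\sum_(i <- r) F i) ⊗ v = \sum_(i <- r) F i ⊗ v.
Proof. by apply: (big_morph (fun u => u ⊗ v)) => [x y|]; rewrite ?pureDl ?pure0l. Qed.

Lemma pure_sumr U V (I : Type) (r : seq I) (F : I -> V) (u : U) :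
  u ⊗ (\sum_(i <- r) F i) = \sum_(i <- r) u ⊗ F i.
Proof. by apply: (big_morph (pure u)) => [x y|]; rewrite ?pureDr ?pure0r. Qed.

(** f ⊗ id and id ⊗ g, as maps to the remaining tensor factor. *)
Definition slicel U V (f : dual U) : tensor U V -> V :=
  tens_lift (fun (u : U) (v : V) => (f u : k) *: v).

Definition slicer U V (g : dual V) : tensor U V -> U :=
  tens_lift (fun (u : U) (v : V) => (g v : k) *: u).

Section SliceLinear.
Variables U V : lmodType k.

Lemma slicel_bilin (f : dual U) : bilin (fun (u : U) (v : V) => (f u : k) *: v).
Proof.
by split=> [v|u] a x y; rewrite ?linearP ?scalerDl ?scalerA // scalerDr !scalerA mulrC.
Qed.

Lemma slicer_bilin (g : dual V) : bilin (fun (u : U) (v : V) => (g v : k) *: u).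
Proof.
by split=> [v|u] a x y; rewrite ?linearP ?scalerDl ?scalerA // scalerDr !scalerA mulrC.
Qed.

Lemma slicel_linear (f : dual U) : linear (@slicel U V f).
Proof. exact: tens_lift_linear (slicel_bilin f). Qed.

Lemma slicer_linear (g : dual V) : linear (@slicer U V g).
Proof. exact: tens_lift_linear (slicer_bilin g). Qed.

HB.instance Definition _ (f : dual U) :=
  GRing.isLinear.Build k (tensor U V) V *:%R (@slicel U V f) (slicel_linear f).
HB.instance Definition _ (g : dual V) :=
  GRing.isLinear.Build k (tensor U V) U *:%R (@slicer U V g) (slicer_linear g).

Lemma slicel_pure (f : dual U) (u : U) (v : V) : slicel f (u ⊗ v) = (f u : k) *: v.
Proof. exact: tens_lift_pure (slicel_bilin f) u v. Qed.

Lemma slicer_pure (g : dual V) (u : U) (v : V) : slicer g (u ⊗ v) = (g v : k) *: u.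
Proof. exact: tens_lift_pure (slicer_bilin g) u v. Qed.

End SliceLinear.

Lemma tens_linear_ext U V M (f g : {linear tensor U V -> M}) :
  (forall u v, f (u ⊗ v) = g (u ⊗ v)) -> f =1 g.
Proof. by apply: tens_ext; apply: linearP. Qed.

Lemma tens_linear_ext3 U V W M (f g : {linear tensor (tensor U V) W -> M}) :
  (forall u v w, f (u ⊗ v ⊗ w) = g (u ⊗ v ⊗ w)) -> f =1 g.
Proof. by apply: tens_ext3; apply: linearP. Qed.

Lemma slicel_ext U V (f g : dual U) (x : tensor U V) :
  f =1 g -> slicel f x = slicel g x.
Proof. by move=> fg; apply: eq_tens_lift => u v; rewrite fg. Qed.

(** Both sides are (f ⊗ g)(x); this transfers information between the two kinds
    of slices. *)
Lemma slice_comm U V (f : dual U) (g : dual V) (x : tensor U V) :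
  g (slicel f x) = f (slicer g x).
Proof.
apply: (tens_linear_ext (f := g \o slicel f) (g := f \o slicer g)) => u v /=.
by rewrite slicel_pure slicer_pure !linearZ_LR /= /GRing.scale /= mulrC.
Qed.

Lemma slicel_map U V U' V' (h : {linear U -> U'}) (l : {linear V -> V'})
    (f : dual U') (x : tensor U V) :
  slicel f (tens_map h l x) = l (slicel (f \o h : dual U) x).
Proof.
apply: (tens_linear_ext (f := slicel f \o tens_map h l)
  (g := l \o slicel (f \o h : dual U))) => u v /=.
by rewrite tens_map_pure !slicel_pure linearZ.
Qed.

Lemma slicer_map U V U' V' (h : {linear U -> U'}) (l : {linear V -> V'})
    (g : dual V') (x : tensor U V) :
  slicer g (tens_map h l x) = h (slicer (g \o l : dual V) x).
Proof.
apply: (tens_linear_ext (f := slicer g \o tens_map h l)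
  (g := h \o slicer (g \o l : dual V))) => u v /=.
by rewrite tens_map_pure !slicer_pure linearZ.
Qed.

Lemma slicel_assoc U V W (f : dual U) (x : tensor (tensor U V) W) :
  slicel f (tens_assoc x) = tens_map (slicel f) idfun x.
Proof.
apply: (tens_linear_ext3 (f := slicel f \o @tens_assoc k U V W)
  (g := tens_map (slicel f) idfun)) => u v w /=.
by rewrite tens_assoc_pure tens_map_pure /= !slicel_pure pureZl.
Qed.

Lemma slicer_assoc U V W (g : dual W) (x : tensor (tensor U V) W) :
  tens_map idfun (slicer g) (tens_assoc x) = slicer g x.
Proof.
apply: (tens_linear_ext3 (f := tens_map idfun (slicer g) \o @tens_assoc k U V W)
  (g := slicer g)) => u v w /=.
by rewrite tens_assoc_pure tens_map_pure /= !slicer_pure pureZr.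
Qed.

Lemma tens_swap_pure U V (u : U) (v : V) : tens_swap (u ⊗ v) = v ⊗ u.
Proof.
apply: (tens_lift_pure (f := fun (u : U) (v : V) => v ⊗ u)).
by split=> [{}v|{}u] a x y; rewrite ?(pure_bilin _ _).1 ?(pure_bilin _ _).2.
Qed.

Lemma tens_swap_linear U V : linear (@tens_swap k U V).
Proof.
apply: tens_lift_linear.
by split=> [v|u] a x y; rewrite ?(pure_bilin _ _).1 ?(pure_bilin _ _).2.
Qed.

HB.instance Definition _ U V := GRing.isLinear.Build k (tensor U V) (tensor V U)
  *:%R (@tens_swap k U V) (@tens_swap_linear U V).

Lemma slicel_swap U V (f : dual V) (x : tensor U V) :
  slicel f (tens_swap x) = slicer f x.
Proof.
apply: (tens_linear_ext (f := slicel f \o @tens_swap k U V) (g := slicer f)) => u v /=.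
by rewrite tens_swap_pure slicel_pure slicer_pure.
Qed.

(** In a shortest expression of x as a sum of pure tensors the components lie in
    P and Q: if some component y.1 is outside of P, a functional killing P with
    value 1 at y.1 expresses y.2 by the other second components, which shortens
    the sum. *)
Lemma slices_tens_in U V (P : U -> Prop) (Q : V -> Prop) (x : tensor U V) :
  subspace P -> subspace Q ->
  (forall f : dual U, (forall u, P u -> f u = 0) -> slicel f x = 0) ->
  (forall g : dual V, (forall v, Q v -> g v = 0) -> slicer g x = 0) ->
  tens_in P Q x.
Proof.
move=> sP sQ xP xQ.
have [s xs] : exists s, x = \sum_(p <- s) p.1 ⊗ p.2 by exists (repr x); apply: tensE.
move: {2}(size s).+1 (ltnSn (size s)) => n.
elim: n s xs => // n IH s xs; rewrite ltnS => sn.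
have [sPQ|] := pselect (forall p, p \in s -> P p.1 /\ Q p.2); first by exists s.
move=> /existsNP [y /not_implyP [ys /not_andP nPQ]].
have szr : (size (rem y s) < n)%N.
  by rewrite size_rem //; move: sn ys; case: (s) => // z s'; rewrite /= => /leq_trans; apply.
case: nPQ => [nP|nQ].
  have [f [fP f1]] := separation sP nP.
  apply: (IH [seq (p.1 - (f p.1 : k) *: y.1, p.2) | p <- rem y s]); last by rewrite size_map.
  have y2 : y.2 = - \sum_(p <- rem y s) (f p.1 : k) *: p.2.
    apply/eqP; rewrite -addr_eq0; apply/eqP; rewrite -[RHS](xP f fP) xs linear_sum.
    rewrite (big_rem y ys) /= slicel_pure f1 scale1r; congr (_ + _).
    by apply: eq_bigr => p _; rewrite slicel_pure.
  rewrite xs (big_rem y ys) /= {1}y2 -scaleN1r pureZr scaleN1r pure_sumr.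
  rewrite big_map /= addrC -sumrB; apply: eq_bigr => p _.
  by rewrite pureBl pureZlr.
have [g [gQ g1]] := separation sQ nQ.
apply: (IH [seq (p.1, p.2 - (g p.2 : k) *: y.2) | p <- rem y s]); last by rewrite size_map.
have y1 : y.1 = - \sum_(p <- rem y s) (g p.2 : k) *: p.1.
  apply/eqP; rewrite -addr_eq0; apply/eqP; rewrite -[RHS](xQ g gQ) xs linear_sum.
  rewrite (big_rem y ys) /= slicer_pure g1 scale1r; congr (_ + _).
  by apply: eq_bigr => p _; rewrite slicer_pure.
rewrite xs (big_rem y ys) /= {1}y1 -scaleN1r pureZl scaleN1r pure_suml.
rewrite big_map /= addrC -sumrB; apply: eq_bigr => p _.
by rewrite pureBr pureZlr.
Qed.

Lemma tens_in_slicel U V (P : U -> Prop) (Q : V -> Prop) (x : tensor U V)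
  (f : dual U) : tens_in P Q x -> (forall u, P u -> f u = 0) -> slicel f x = 0.
Proof.
case=> s [sPQ ->] fP; rewrite linear_sum big_seq big1 // => p /sPQ [Pp _].
by rewrite /= slicel_pure fP // scale0r.
Qed.

Lemma tens_in_slicer U V (P : U -> Prop) (Q : V -> Prop) (x : tensor U V)
  (g : dual V) : tens_in P Q x -> (forall v, Q v -> g v = 0) -> slicer g x = 0.
Proof.
case=> s [sPQ ->] gQ; rewrite linear_sum big_seq big1 // => p /sPQ [_ Qp].
by rewrite /= slicer_pure gQ // scale0r.
Qed.

Lemma slicel_eq0 U V (x : tensor U V) : (forall f : dual U, slicel f x = 0) -> x = 0.
Proof.
move=> h; have [|s [s0 ->]] := slices_tens_in (subspace_zero U) (subspace_true V)
  (fun f _ => h f) (x := x).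
  move=> g _; apply: separating => f; rewrite -slice_comm h; exact: linear0.
by rewrite big_seq big1 // => p /s0 [-> _]; rewrite pure0l.
Qed.

Lemma slicel_inj U V (x y : tensor U V) :
  (forall f : dual U, slicel f x = slicel f y) -> x = y.
Proof.
by move=> h; apply/subr0_eq/slicel_eq0 => f; rewrite linearB /= h subrr.
Qed.

Lemma slicer_inj U V (x y : tensor U V) :
  (forall g : dual V, slicer g x = slicer g y) -> x = y.
Proof.
move=> h; apply: slicel_inj => f; apply/subr0_eq/separating => g.
by rewrite !linearB /= !slice_comm h subrr.
Qed.

(** Membership in P ⊗ Q is a condition on slices.  Since slices are compatible
    with intersections, so is P ⊗ Q, which is what makes intersections of
    subcoalgebras subcoalgebras. *)
Lemma tens_inP U V (P : U -> Prop) (Q : V -> Prop) (x : tensor U V) :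
  subspace P -> subspace Q ->
  tens_in P Q x <->
  (forall f : dual U, Q (slicel f x)) /\ (forall g : dual V, P (slicer g x)).
Proof.
move=> sP sQ; split=> [xPQ|[xQ xP]].
  split=> [f|g]; apply: subspace_dualP => // h hE.
    by rewrite slice_comm (tens_in_slicer xPQ hE) linear0.
  by rewrite -slice_comm (tens_in_slicel xPQ hE) linear0.
apply: slices_tens_in => // h hE; apply: separating => g.
  by rewrite slice_comm hE.
by rewrite -slice_comm hE.
Qed.

Lemma tens_map_id U V (x : tensor U V) : tens_map idfun idfun x = x.
Proof.
apply: (tens_linear_ext (f := tens_map idfun idfun) (g := idfun)) => u v.
exact: (tens_map_pure idfun idfun).
Qed.

Lemma tens_map_injl U U' V (f : {linear U -> U'}) :
  injective f -> injective (tens_map (f : U -> U') (idfun : V -> V)).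
Proof.
move=> fi x y xy; apply: slicer_inj => g; apply: fi.
by rewrite -!(slicer_map f idfun g) xy.
Qed.

End Slices.

Lemma tens_lift_sum (k : fieldType) (U V M N : lmodType k) (h : {linear M -> N})
  (f : U -> V -> M) (x : tensor U V) :
  h (tens_lift f x) = tens_lift (fun u v => h (f u v)) x.
Proof. exact: linear_sum. Qed.

(** * Coefficients of comodules *)

Section Comodules.
Variables (k : fieldType) (C : coalgType k).
Implicit Types (M N : comodule C) (D E : C -> Prop).

Definition regular_comod : comodule C := Comodule (@comulA k C) (@counitr k C).

Section OneComodule.
Variable M : comodule C.
Implicit Type v : M.

(** The coefficient of v along f, that is f(v_0) v_1, and the action of the dual
    algebra on a comodule, g.v = g(v_1) v_0. *)
Definition coef (f : dual M) v : C := slicel f (coact v).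
Definition act (g : dual C) v : M := slicer g (coact v).

HB.instance Definition _ (f : dual M) := GRing.Linear.copy (coef f) (slicel f \o coact).
HB.instance Definition _ (g : dual C) := GRing.Linear.copy (act g) (slicer g \o coact).

Lemma act_counit v : act counit v = v.
Proof. exact: coact_counit. Qed.

Lemma coact_act (g : dual C) v :
  coact (act g v) = tens_map idfun (slicer g \o comul) (coact v).
Proof.
rewrite -(tens_map_comp idfun comul idfun (slicer g)).
rewrite -coactA slicer_assoc (slicer_map coact idfun g); congr (coact _).
Qed.

(** Δ(f(v_0) v_1) = f(v_0) v_1 ⊗ v_2: taking coefficients along a fixed f is
    colinear from M to the regular comodule. *)
Lemma comul_coef (f : dual M) v :
  comul (coef f v) = tens_map (coef f) idfun (coact v).
Proof.
transitivity (tens_map (slicel f) idfun (tens_map coact idfun (coact v))).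
  by rewrite -slicel_assoc coactA (slicel_map idfun comul f).
by rewrite tens_map_comp.
Qed.

Lemma counit_coef (f : dual M) v : counit (coef f v) = f v.
Proof. by rewrite /coef slice_comm -/(act _ _) act_counit. Qed.

Lemma act_coef (f : dual M) (g : dual C) v : g (coef f v) = f (act g v).
Proof. exact: slice_comm. Qed.

(** Subcomodules are the submodules for the action of the dual algebra. *)
Lemma subcomoduleP (P : M -> Prop) :
  subcomodule P <-> subspace P /\ forall g v, P v -> P (act g v).
Proof.
split=> [[sP Pc]|[sP Pa]]; split=> //.
  move=> g v Pv.
  by have [_ h] := (tens_inP _ sP (subspace_true C)).1 (Pc v Pv); apply: h.
move=> v Pv; apply: (tens_inP _ sP (subspace_true C)).2.
by split=> // g; apply: Pa.
Qed.

Definition coefs : C -> Prop := linspan (fun c => exists f v, c = coef f v).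

Lemma coefs_mem f v : coefs (coef f v).
Proof. by apply: linspan_mem; exists f, v. Qed.

End OneComodule.

Lemma subcoalgebraP D : subcoalgebra D <->
  subspace D /\ forall d, D d ->
    (forall f, D (slicel f (comul d))) /\ (forall g, D (slicer g (comul d))).
Proof.
split=> [[sD Dc]|[sD Dc]]; split=> // d Dd.
  exact: ((tens_inP _ sD sD).1 (Dc d Dd)).
by apply/tens_inP => //; apply: Dc.
Qed.

Lemma comul_counitl (c : C) : slicel counit (comul c) = c.
Proof. exact: counitl. Qed.

Lemma comul_counitr (c : C) : slicer counit (comul c) = c.
Proof. exact: counitr. Qed.

Lemma subcoalgebra_linspan (I : Type) (S : I -> Prop) (F : I -> C -> Prop) :
  (forall i, S i -> subcoalgebra (F i)) ->
  subcoalgebra (linspan (fun x => exists i, S i /\ F i x)).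
Proof.
move=> sF; apply/subcoalgebraP; split=> [|d]; first exact: linspan_subspace.
set T := linspan _ => Td.
have sT : subspace T by apply: linspan_subspace.
split=> h.
  apply: (Td _ (subspace_preim (slicel h \o comul) sT)) => x [i [Si Fx]].
  by apply: linspan_mem; exists i; split=> //; apply: (((subcoalgebraP _).1 (sF i Si)).2 x Fx).1.
apply: (Td _ (subspace_preim (slicer h \o comul) sT)) => x [i [Si Fx]].
by apply: linspan_mem; exists i; split=> //; apply: (((subcoalgebraP _).1 (sF i Si)).2 x Fx).2.
Qed.

Lemma subcoalgebraI D E :
  subcoalgebra D -> subcoalgebra E -> subcoalgebra (fun x => D x /\ E x).
Proof.
move=> /subcoalgebraP[sD Dc] /subcoalgebraP[sE Ec]; apply/subcoalgebraP.
split=> [|d [/Dc [Dl Dr] /Ec [El Er]]]; first exact: subspaceI.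
by split=> f; split.
Qed.

Lemma coefs_subcoalgebra M : subcoalgebra (coefs M).
Proof.
apply/subcoalgebraP; split=> [|c Tc]; first exact: linspan_subspace.
have sT : subspace (coefs M) by apply: linspan_subspace.
split=> h.
  apply: (Tc _ (subspace_preim (slicel h \o comul) sT)) => _ [f [v ->]] /=.
  rewrite comul_coef (slicel_map (coef f) idfun h); exact: coefs_mem.
apply: (Tc _ (subspace_preim (slicer h \o comul) sT)) => _ [f [v ->]] /=.
rewrite comul_coef (slicer_map (coef f) idfun h); exact: coefs_mem.
Qed.

Lemma colinearP M N (f : {linear M -> N}) :
  colinear f <-> forall g v, f (act g v) = act g (f v).
Proof.
split=> [fc g v|fa v]; first by rewrite /act fc (slicer_map f idfun g).
by apply: slicer_inj => g; rewrite (slicer_map f idfun g); apply/esym/fa.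
Qed.

Lemma subcoalgebra_subcomodule D : subcoalgebra D -> subcomodule (M := regular_comod) D.
Proof.
move=> /subcoalgebraP[sD Dc]; apply/subcomoduleP; split=> // g v /Dc [_]; exact.
Qed.

(** By x = ε(x_1) x_2, since both factors of the coproduct of x lie in D. *)
Lemma subcoalgebra_eq0 D : subcoalgebra D -> (forall x, D x -> counit x = 0) ->
  forall x, D x -> x = 0.
Proof.
move=> [_ Dc] De x Dx; rewrite -[x]comul_counitl.
exact: (tens_in_slicel (Dc x Dx)).
Qed.

(** The product of the dual algebra acting on right comodules: (g h)(c) =
    g(c_1) h(c_2). *)
Definition conv (g h : dual C) : dual C := g \o slicer h \o comul.

Lemma act_act M g h (v : M) : act g (act h v) = act (conv g h) v.
Proof.
rewrite {1}/act coact_act (slicer_map idfun (slicer h \o comul) g) /=; congr (slicer _ _).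
Qed.

End Comodules.
Arguments coef {k C M} f v.
Arguments act {k C M} g v.
Arguments regular_comod {k} C.

(** * The coproduct of an antipode *)

(** Coassociativity for a trilinear expression T: the Sweedler expression
    T v_0 v_1 v_2 is unambiguous. *)
Lemma tens_lift_coassoc (k : fieldType) (C : coalgType k) (M : comodule C)
    (N : lmodType k) (T : M -> C -> C -> N) :
  (forall b d, linear (fun m => T m b d)) -> (forall m, bilin (T m)) ->
  forall v : M,
  tens_lift (fun m d => tens_lift (fun m' b => T m' b d) (coact m)) (coact v)
  = tens_lift (fun m c => tens_lift (T m) (comul c)) (coact v).
Proof.
move=> T1 T23 v.
have Lb : bilin (fun (m : M) (y : tensor C C) => tens_lift (T m) y).
  split=> [y|m]; last exact: tens_lift_linear.
  move=> a m m'; rewrite /tens_lift scaler_sumr -big_split /=.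
  by apply: eq_bigr => p _; rewrite T1.
have T12 d : bilin (fun m' b => T m' b d).
  by split=> [b|m]; [apply: T1|apply: (T23 m).1].
have L'b : bilin (fun (x : tensor M C) (d : C) => tens_lift (fun m' b => T m' b d) x).
  split=> [d|x]; first exact: tens_lift_linear.
  move=> a m m'; rewrite /tens_lift scaler_sumr -big_split /=.
  by apply: eq_bigr => p _; rewrite (T23 _).2.
rewrite -(tens_lift_map coact idfun L'b) -(tens_lift_map idfun comul Lb) -coactA.
set z := tens_map _ _ _; clearbody z; move: z.
apply: tens_ext3; first exact: tens_lift_linear.
  by move=> a x y; rewrite linearP /= (tens_lift_linear Lb).
move=> m b d; rewrite tens_assoc_pure (tens_lift_pure Lb) (tens_lift_pure L'b).
by rewrite (tens_lift_pure (T12 d)) (tens_lift_pure (T23 m)).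
Qed.

Section RightMul.
Variables (k : fieldType) (A : algType k).

Definition rmul (a x : A) : A := x * a.

Lemma rmul_linear a : linear (rmul a).
Proof. by move=> c x y; rewrite /rmul mulrDl scalerAl. Qed.

HB.instance Definition _ a := GRing.isLinear.Build k A A *:%R (rmul a) (rmul_linear a).

Lemma tens_map_rmul_bilin (x : tensor A A) :
  bilin (fun b d => tens_map (rmul b) (rmul d) x).
Proof.
split=> [d|b] a y z; rewrite /tens_map /tens_lift scaler_sumr -big_split /=;
  apply: eq_bigr => p _; rewrite /rmul mulrDr -scalerAr.
  by rewrite (pure_bilin _ _).1.
by rewrite (pure_bilin _ _).2.
Qed.

Lemma tens_mulE (x y : tensor A A) :
  tens_mul x y = tens_lift (fun b d => tens_map (rmul b) (rmul d) x) y.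
Proof.
move: x y; apply: bilin_ext; first exact: tens_mul_bilin.
  split=> [y|x]; last exact: tens_lift_linear (tens_map_rmul_bilin x).
  move=> a u v; rewrite /tens_lift scaler_sumr -big_split /=.
  by apply: eq_bigr => p _; rewrite linearP.
move=> u v u' v'.
by rewrite tens_mul_pure (tens_lift_pure (tens_map_rmul_bilin _)) tens_map_pure.
Qed.

Lemma tens_mul_rmul (c : A) (x y : tensor A A) :
  tens_map (rmul c) idfun (tens_mul x y) = tens_mul x (tens_map (rmul c) idfun y).
Proof.
move: x y; apply: bilin_ext.
- apply: (linear_bilin (l := tens_map (rmul c) idfun) (tens_mul_bilin A)); exact: linearP.
- apply: (bilin_comp (f := idfun) (g := tens_map (rmul c) idfun) (tens_mul_bilin A)) => //.
  exact: linearP.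
move=> u v u' v'; rewrite tens_map_pure !tens_mul_pure tens_map_pure.
by rewrite /rmul mulrA.
Qed.

End RightMul.

Section Antipode.
Variables (k : fieldType) (B : hopfType k).
Local Notation S := (@antipode k B).

(** Δ(S(c_1)) (c_2 ⊗ 1) = 1 ⊗ S(c), a form of the anticomultiplicativity of the
    antipode.  With F(c) the left side, F(c_1) (1 ⊗ c_2) = Δ(S(c_1) c_2) = ε(c),
    and multiplying on the right by 1 ⊗ S(c_3) recovers F(c). *)
Lemma antipode_comul (c : B) :
  tens_lift (fun a b => tens_map (rmul b) idfun (comul (S a))) (comul c)
  = (1 : B) ⊗ S c.
Proof.
pose F0 (c : B) := tens_lift (fun a b => tens_map (rmul b) idfun (comul (S a))) (comul c).
rewrite -/(F0 c).
have Fb : bilin (fun a b => tens_map (rmul b) idfun (comul (S a))).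
  split=> [b|a]; first by move=> x y z; rewrite !linearP.
  move=> x y z; rewrite /tens_map /tens_lift scaler_sumr -big_split /=.
  by apply: eq_bigr => p _; rewrite /rmul mulrDr -scalerAr (pure_bilin _ _).1.
have [F FE] : exists F : {linear B -> tensor B B}, F =1 F0.
  by apply: bundle_linear => a x y; rewrite /F0 linearP; apply: tens_lift_linear.
rewrite -FE.
(* F(x_1) (1 ⊗ x_2) = ε(x) *)
have Finv x : tens_lift (fun x d => tens_map idfun (rmul d) (F x)) (comul x)
    = (counit x : k) *: ((1 : B) ⊗ (1 : B)).
  pose G (a b d : B) := tens_map (rmul b) (rmul d) (comul (S a)).
  transitivity (tens_lift (fun x d => tens_lift (fun a b => G a b d) (comul x)) (comul x)).
    apply: eq_tens_lift => y d; rewrite FE /F0 (tens_lift_sum (tens_map idfun (rmul d))).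
    by apply: eq_tens_lift => a b /=; rewrite tens_map_comp.
  rewrite (tens_lift_coassoc (M := regular_comod B) (T := G)); last 2 first.
  - by move=> b d a y z; rewrite /G !linearP.
  - by move=> m; apply: tens_map_rmul_bilin.
  transitivity (comul (tens_lift (fun a y => S a * y) (comul x))).
    rewrite (tens_lift_sum comul); apply: eq_tens_lift => a y.
    by rewrite comulM tens_mulE.
  by rewrite antipodel linearZ_LR /= comul1.
(* F(x) (1 ⊗ b S(d)), so that F(c) = H c_1 c_2 c_3. *)
pose H (x b d : B) := tens_map idfun (rmul (b * S d)) (F x).
have HE x b d : H x b d = tens_map idfun (rmul (S d)) (tens_map idfun (rmul b) (F x)).
  by rewrite tens_map_comp; apply: eq_tens_map => // y; rewrite /= /rmul mulrA.
have rb (X : tensor B B) : linear (fun b => tens_map idfun (rmul b) X).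
  move=> x y z; rewrite /tens_map /tens_lift scaler_sumr -big_split /=.
  by apply: eq_bigr => p _; rewrite /rmul mulrDr -scalerAr (pure_bilin _ _).2.
have Hb x : bilin (H x).
  split=> [d|b] a y z; rewrite /H.
    by rewrite mulrDl -scalerAl rb.
  by rewrite linearP mulrDr -scalerAr rb.
transitivity (tens_lift (fun x e => tens_lift (H x) (comul e)) (comul c)).
  rewrite -{1}[c]counitr (tens_lift_sum F); apply: eq_tens_lift => x e.
  have [r rE] := bundle_linear (rb (F x)).
  transitivity (r (tens_lift (fun b d => b * S d) (comul e))).
    rewrite antipoder !linearZ_LR /= rE; congr (_ *: _).
    rewrite -[LHS](tens_map_id); apply: eq_tens_map => // y.
    by rewrite /rmul mulr1.
  by rewrite (tens_lift_sum r); apply: eq_tens_lift => b d; rewrite rE.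
rewrite -(tens_lift_coassoc (M := regular_comod B) (T := H)) //; last first.
  by move=> b d a y z; rewrite /H !linearP.
transitivity ((1 : B) ⊗ S (tens_lift (fun x y => (counit x : k) *: y) (comul c))); last first.
  by rewrite counitl.
have [l lE] := bundle_linear ((pure_bilin B B).2 1).
rewrite -lE -[RHS]/((l \o S) _) (tens_lift_sum (l \o S)); apply: eq_tens_lift => y d /=.
rewrite linearZ_LR /= linearZ_LR /= lE.
transitivity (tens_map idfun (rmul (S d))
    (tens_lift (fun x b => tens_map idfun (rmul b) (F x)) (comul y))).
  rewrite (tens_lift_sum (tens_map idfun (rmul (S d)))).
  by apply: eq_tens_lift => x b; rewrite HE.
by rewrite Finv linearZ_LR /= tens_map_pure /= /rmul mul1r.
Qed.

End Antipode.

(** * The invariant integral and orthogonality *)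

Section Haar.
Variables (k : fieldType) (B : hopfType k).

(** The second condition reads b_1 λ(b_2) = λ(b) 1. *)
Definition invariant_integral (l : dual B) : Prop :=
  (l 1 : k) = 1 /\ forall b : B, slicer l (comul b) = (l b : k) *: 1.

(** Induction on the number of terms: a functional killing the subcoalgebra of
    the first term, with value 1 at 1, applied to the left factor of Δ, turns a
    sum equal to 1 into a shorter sum of the same kind. *)
Lemma one_notin_sum (s : seq B) :
  (forall x, x \in s -> exists2 D, subcoalgebra D & D x /\ ~ D 1) ->
  \sum_(x <- s) x <> 1.
Proof.
have [n] := ubnP (size s); elim: n s => // n IH [|x s] ltn sD.
  by rewrite big_nil => /eqP; rewrite eq_sym oner_eq0.
rewrite big_cons => x1.
have [D sCD [Dx nD1]] := sD x (mem_head _ _).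
have [f [fD f1]] := separation sCD.1 nD1.
apply: (IH [seq slicel f (comul y) | y <- s]).
- by rewrite size_map.
- move=> _ /mapP[y ys ->]; have [|E sE [Ey nE1]] := sD y; first by rewrite inE ys orbT.
  by exists E => //; split=> //; apply: (((subcoalgebraP _).1 sE).2 y Ey).1.
have := congr1 (slicel f \o comul) x1; rewrite /= comul1 slicel_pure f1 scale1r.
rewrite linearD linearD /= (tens_in_slicel (sCD.2 x Dx) fD) add0r !linear_sum.
by rewrite big_map.
Qed.

(** The line through 1 is a simple subcoalgebra, and 1 is not in the sum N of
    the other ones.  A functional that is 0 on N and 1 at 1 is invariant, since
    N is a subcoalgebra. *)
Lemma exists_integral : cosemisimple B -> exists l : dual B, invariant_integral l.
Proof.
move=> hB.
pose S (D : B -> Prop) := simple_subcoalgebra D /\ ~ D 1.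
pose N := linspan (fun x => exists D, S D /\ D x).
have sN : subcoalgebra N.
  by apply: (@subcoalgebra_linspan _ _ _ S (fun D => D)) => D [[]].
have nN1 : ~ N 1.
  move=> N1; have [|s [sS s1]] := linspan_cone_sum _ N1.
    move=> a x [D [SD Dx]]; exists D; split=> //.
    by apply: subspaceZ => //; case: SD => -[] [].
  by apply: (@one_notin_sum s) => // x /sS [D [[[sD _] nD1] Dx]]; exists D.
have [l [lN l1]] := separation sN.1 nN1; exists l; split=> // b.
have [s [sD ->]] := hB b.
rewrite !linear_sum scaler_suml big_seq [RHS]big_seq; apply: eq_bigr => x /sD [D simD Dx] /=.
have [D1|nD1] := pselect (D 1); last first.
  have Nx : N x by apply: linspan_mem; exists D.
  by rewrite lN // scale0r (tens_in_slicer (sN.2 x Nx) lN).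
(* D contains 1, so it is the line E. *)
pose E (y : B) := exists a : k, y = a *: 1.
have sE : subcoalgebra E.
  apply/subcoalgebraP; split=> [|_ [a ->]].
    split=> [|a _ _ [c ->] [d ->]]; first by exists 0; rewrite scale0r.
    by exists (a * c + d); rewrite scalerDl scalerA.
  rewrite linearZ_LR /= comul1; split=> f; rewrite linearZ_LR /= ?slicel_pure ?slicer_pure scalerA;
  by eexists.
have [E0|DE] : (forall y, E y -> y = 0) \/ (forall y, D y -> E y).
  apply: (simD.2.2 E sE) => _ [a ->].
  by apply: subspaceZ => //; case: simD => -[].
  have /eqP := E0 1 (ex_intro _ 1 (esym (scale1r _))).
  by rewrite oner_eq0.
have [a ->] := DE x Dx.
rewrite !linearZ_LR /= comul1 slicer_pure scalerA; congr (_ *: _).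
Qed.

Variables (l : dual B) (hl : invariant_integral l).
Local Notation S := (@antipode k B).

(** b_1 λ(b_2 S(c)) = λ(b S(c_1)) c_2, from the invariance of λ applied to the
    product b S(c_1) and [antipode_comul]. *)
Lemma integral_antipode (b c : B) :
  slicer (l \o rmul (S c) : dual B) (comul b)
  = tens_lift (fun x y => (l (b * S x) : k) *: y) (comul c).
Proof.
have [m mE] := bundle_linear ((tens_mul_bilin B).2 (comul b)).
transitivity (slicer l (m ((1 : B) ⊗ S c))).
  rewrite mE.
  have [m' m'E] := bundle_linear ((tens_mul_bilin B).1 ((1 : B) ⊗ S c)).
  rewrite -m'E.
  apply: (tens_linear_ext (f := slicer (l \o rmul (S c) : dual B)) (g := slicer l \o m')) => u v.
  by rewrite /= m'E tens_mul_pure !slicer_pure mulr1.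
rewrite -antipode_comul -[LHS]/((slicer l \o m) _) (tens_lift_sum (slicer l \o m)).
apply: eq_tens_lift => x y /=.
rewrite mE -tens_mul_rmul (slicer_map (rmul y) idfun l) -comulM.
transitivity (rmul y (slicer l (comul (b * S x)))); first by [].
by rewrite hl.2 /rmul -scalerAl mul1r.
Qed.

Section Orthogonality.
Variables X Y : comodule B.

(** c |-> y_0 λ(y_1 S(c)).  Composed with the coefficient map of X along f, it is
    the average over B of the rank one map x |-> f(x) y. *)
Definition average (y : Y) (c : B) : Y := slicer (l \o rmul (S c) : dual B) (coact y).

Lemma average_linear y : linear (average y).
Proof.
move=> a c d; rewrite /average /slicer /tens_lift scaler_sumr -big_split /=.
apply: eq_bigr => p _.
by rewrite /rmul linearP mulrDr -scalerAr linearP scalerDl scalerA.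
Qed.

HB.instance Definition _ y := GRing.isLinear.Build k B Y *:%R (average y) (average_linear y).

Lemma average_colinear y : colinear (M := regular_comod B) (average y).
Proof.
move=> c /=; rewrite -/(act _ _) coact_act.
transitivity (\sum_(p <- repr (coact y))
    p.1 ⊗ tens_lift (fun x z => (l (p.2 * S x) : k) *: z) (comul c)).
  rewrite {1}[coact y]tensE linear_sum; apply: eq_bigr => p _.
  by rewrite /= tens_map_pure /= integral_antipode.
have bl (b : B) : bilin (fun x z : B => (l (b * S x) : k) *: z).
  split=> [z|x] a u v; first by rewrite linearP mulrDr -scalerAr linearP scalerDl scalerA.
  by rewrite scalerDr !scalerA mulrC.
have [h hE] : exists h : {linear tensor B B -> tensor Y B}, h =1
    (fun z => \sum_(p <- repr (coact y)) p.1 ⊗ tens_lift (fun x z => (l (p.2 * S x) : k) *: z) z).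
  apply: bundle_linear => a u v; rewrite scaler_sumr -big_split; apply: eq_bigr => p _ /=.
  by rewrite (tens_lift_linear (bl _)) (pure_bilin _ _).2.
rewrite -hE; apply: (tens_linear_ext (g := tens_map (average y) idfun)) => u v.
rewrite hE [RHS](tens_map_pure (average y) idfun).
transitivity (\sum_(p <- repr (coact y)) p.1 ⊗ ((l (p.2 * S u) : k) *: v)).
  by apply: eq_bigr => p _; rewrite (tens_lift_pure (bl _)).
rewrite /average /slicer /tens_lift pure_suml.
by apply: eq_bigr => p _; rewrite pureZlr.
Qed.

(** The averaged map vanishes by hypothesis; evaluating a functional on it gives
    λ(d S(c)). *)
Lemma orthogonality : ~ hom_nonzero X Y ->
  forall c d, coefs X c -> coefs Y d -> (l (d * S c) : k) = 0.
Proof.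
move=> nh c d Xc Yd.
have lb : bilin (fun d c : B => l (d * S c)).
  split=> [z|x] a u v; first by rewrite mulrDl -scalerAl linearP.
  by rewrite linearP mulrDr -scalerAr linearP.
have [l1 l1E] := bundle_linear (lb.1 c).
rewrite -[LHS]l1E; apply: (Yd _ (subspace_ker l1)) => _ [f [y ->]]; rewrite l1E.
have [l2 l2E] := bundle_linear (lb.2 (coef f y)).
rewrite -[LHS]l2E; apply: (Xc _ (subspace_ker l2)) => _ [g [x ->]]; rewrite l2E.
apply: contrapT => n0; apply: nh; exists (average y \o coef g).
  move=> v; rewrite /= average_colinear /= comul_coef tens_map_comp.
  exact: eq_tens_map.
exists x; apply/eqP => /= h0; apply: n0.
rewrite -[l _]/((l \o rmul (S (coef g x)) : dual B) (coef f y)) act_coef.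
by rewrite -[RHS](linear0 f) -h0.
Qed.

End Orthogonality.

(** ε(y) = λ(y_1 S(y_2)), and for y in both D and E the coproduct can be written
    with left factors in D and right factors in E. *)
Lemma orthogonal_disjoint (D E : B -> Prop) :
  subcoalgebra D -> subcoalgebra E ->
  (forall d e, D d -> E e -> (l (d * S e) : k) = 0) ->
  forall x, D x -> E x -> x = 0.
Proof.
move=> sD sE DE x Dx Ex.
have sI := subcoalgebraI sD sE.
apply: (subcoalgebra_eq0 sI) => // y Iy.
have [s [sP yE]] := sI.2 y Iy.
have : l ((counit y : k) *: (1 : B)) = 0.
  rewrite -antipoder yE.
  have mb : bilin (fun a b : B => a * S b).
    by split=> [b|a] c u v; rewrite ?mulrDl -?scalerAl // linearP mulrDr -scalerAr.
  have [m mE] := bundle_linear (tens_lift_linear mb).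
  rewrite -mE !linear_sum big_seq big1 // => p /sP [[D1 _] [_ E2]] /=.
  by rewrite mE (tens_lift_pure mb) DE.
by rewrite linearZ_LR /= hl.1 /GRing.scale /= mulr1.
Qed.

End Haar.

(** * Simple comodules *)

Section SubLmodule.
Variables (k : fieldType) (M : lmodType k) (P : M -> Prop).

Definition sub_pred : pred M := fun v => `[< P v >].
(** The subspace P as a type.  The proof that P is a subspace is an argument of
    the type, so that the module structure can be found from the type alone. *)
Definition sub_car (sP : subspace P) := {v : M | sub_pred v}.

Variable sP : subspace P.
Local Notation U := (sub_car sP).
HB.instance Definition _ := Choice.on U.
HB.instance Definition _ := SubType.on U.

Lemma sub_pred_closed : subsemimod_closed sub_pred.
Proof.
split; first split; first exact/asboolP/sP.1.
  by move=> x y /asboolP Px /asboolP Py; apply/asboolP; apply: subspaceD.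
by move=> a x /asboolP Px; apply/asboolP; apply: subspaceZ.
Qed.

HB.instance Definition _ :=
  GRing.SubChoice_isSubLmodule.Build k M sub_pred U sub_pred_closed.

Definition sub_val : {linear U -> M} := \val.

Lemma sub_val_inj : injective sub_val.
Proof. exact: val_inj. Qed.

Lemma sub_valP (u : U) : P (sub_val u).
Proof. exact/asboolP/(valP u). Qed.

Lemma sub_lift (v : M) : P v -> exists u : U, sub_val u = v.
Proof. by move=> /asboolP Pv; exists (Sub v Pv); apply: SubK. Qed.

End SubLmodule.

Section SubComodule.
Variables (k : fieldType) (C : coalgType k) (M : comodule C) (P : M -> Prop).
Hypothesis sP : subcomodule P.
Local Notation U := (sub_car sP.1).
Local Notation iota := (sub_val sP.1).

(** The coaction of a subcomodule takes values in P ⊗ C, which embeds in M ⊗ C. *)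
Lemma sub_coact_exists : exists c : {linear U -> tensor U C},
  forall u, tens_map iota idfun (c u) = coact (iota u).
Proof.
have iota_inj := tens_map_injl (V := C) (@sub_val_inj _ _ _ sP.1).
have ex u : exists z, tens_map iota idfun z = coact (iota u).
  have [s [sPs ->]] := sP.2 _ (sub_valP u).
  elim: s sPs => [_|p s IH sPs]; first by exists 0; rewrite linear0 big_nil.
  have [|z zE] := IH; first by move=> q qs; apply: sPs; rewrite inE qs orbT.
  have [u' u'E] := sub_lift sP.1 (sPs _ (mem_head _ _)).1.
  exists (u' ⊗ p.2 + z).
  transitivity (tens_map iota (idfun : C -> C) (u' ⊗ p.2) + tens_map iota (idfun : C -> C) z).
    exact: linearD.
  by rewrite (tens_map_pure iota idfun) u'E zE big_cons.
have [c0 c0E] := choice ex.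
have [c cE] : exists c : {linear U -> tensor U C}, c =1 c0.
  apply: bundle_linear => a x y; apply: iota_inj.
  by rewrite [RHS](tens_map_linear iota idfun) !c0E !linearP.
by exists c => u; rewrite cE c0E.
Qed.

Lemma subcomodule_inclusion : exists (N : comodule C) (i : {linear N -> M}),
  [/\ colinear i, injective i & forall v, P v <-> exists u, i u = v].
Proof.
have [c cE] := sub_coact_exists.
have cA u : tens_assoc (tens_map c idfun (c u)) = tens_map idfun comul (c u).
  apply: (tens_map_injl (@sub_val_inj _ _ _ sP.1)).
  have -> z : tens_map iota idfun (tens_assoc z)
      = tens_assoc (tens_map (tens_map iota (idfun : C -> C)) (idfun : C -> C) z).
    by rewrite tens_assoc_map; apply: eq_tens_map => // x; rewrite tens_map_id.
  rewrite tens_map_comp.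
  transitivity (tens_assoc (tens_map coact idfun (tens_map iota idfun (c u)))).
    by rewrite tens_map_comp; congr tens_assoc; apply: eq_tens_map.
  rewrite cE coactA -cE !tens_map_comp; exact: eq_tens_map.
have cC u : tens_lift (fun (w : U : lmodType k) (c : C) => counit c *: w) (c u) = u.
  apply: (@sub_val_inj _ _ _ sP.1).
  by rewrite -[RHS]act_counit /act -cE (slicer_map iota idfun counit).
exists (Comodule cA cC), iota; split; first by move=> u; rewrite cE.
  exact: sub_val_inj.
move=> v; split=> [/(sub_lift sP.1)//|[u <-]]; exact: sub_valP.
Qed.

End SubComodule.

Section FiniteDimension.
Variable k : fieldType.
Implicit Types V : lmodType k.

Definition spanned_by V n (v : 'I_n -> V) (P : V -> Prop) : Prop :=
  forall x, P x -> exists a : 'I_n -> k, x = \sum_i a i *: v i.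

Definition independent V n (v : 'I_n -> V) : Prop :=
  forall a : 'I_n -> k, \sum_i a i *: v i = 0 -> forall i, a i = 0.

Lemma combination_subspace V n (v : 'I_n -> V) :
  subspace (fun x => exists a : 'I_n -> k, x = \sum_i a i *: v i).
Proof.
split=> [|c _ _ [a ->] [b ->]].
  by exists (fun _ => 0); rewrite big1 // => i _; rewrite scale0r.
exists (fun i => c * a i + b i); rewrite scaler_sumr -big_split /=.
by apply: eq_bigr => i _; rewrite scalerDl scalerA.
Qed.

(** A functional f killing P with f(v_i) = 1 makes every combination lying in P a
    combination of the vectors v_j - f(v_j) v_i for j other than i. *)
Lemma spanned_by_proper V n (v : 'I_n.+1 -> V) (P : V -> Prop) i :
  subspace P -> spanned_by v P -> ~ P (v i) -> exists v' : 'I_n -> V, spanned_by v' P.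
Proof.
move=> sP vP nPi; have [f [fP f1]] := separation sP nPi.
exists (fun j => v (lift i j) - (f (v (lift i j)) : k) *: v i) => x Px.
have [a xE] := vP x Px; exists (fun j => a (lift i j)).
have ai : a i = - \sum_j a (lift i j) * f (v (lift i j)).
  apply/eqP; rewrite -addr_eq0; apply/eqP; rewrite -[RHS](fP x Px) xE linear_sum.
  rewrite (bigD1_ord i) //= linearZ_LR /= f1 /GRing.scale /= mulr1; congr (_ + _).
  by apply: eq_bigr => j _; rewrite linearZ_LR.
rewrite xE (bigD1_ord i) //= ai scaleNr scaler_suml addrC -sumrB.
by apply: eq_bigr => j _; rewrite scalerBr scalerA.
Qed.

Lemma spanned_by_dependent V n (v : 'I_n.+1 -> V) (P : V -> Prop) a i :
  spanned_by v P -> \sum_i a i *: v i = 0 -> a i != 0 ->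
  exists v' : 'I_n -> V, spanned_by v' P.
Proof.
move=> vP a0 ai; exists (fun j => v (lift i j)) => x Px.
have [b xE] := vP x Px; exists (fun j => b (lift i j) - b i / a i * a (lift i j)).
have -> : x = x - (b i / a i) *: \sum_i a i *: v i by rewrite a0 scaler0 subr0.
rewrite xE scaler_sumr -sumrB (bigD1_ord i) //= scalerA divfK // subrr add0r.
by apply: eq_bigr => j _; rewrite scalerA -scalerBl.
Qed.

Lemma exists_basis V n (v : 'I_n -> V) : spanned_by v (fun _ => True) ->
  exists m (e : 'I_m -> V), spanned_by e (fun _ => True) /\ independent e.
Proof.
elim: n v => [|n IH] v vV; first by exists 0%N, v; split=> // a _ [].
have [ind|] := pselect (independent v); first by exists n.+1, v.
move=> /existsNP[a /not_implyP[a0 /existsNP[i /eqP ai]]].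
have [v' v'V] := spanned_by_dependent vV a0 ai.
exact: IH v'V.
Qed.

End FiniteDimension.

Section SimpleComodules.
Variables (k : fieldType) (C : coalgType k).
Implicit Types M N : comodule C.

(** The subcomodule generated by v.  It is finite-dimensional: it lies in the span
    of the left factors of the coaction of v. *)
Definition orbit M (v : M) : M -> Prop := linspan (fun w => exists g, w = act g v).

Lemma orbit_subcomodule M (v : M) : subcomodule (orbit v).
Proof.
apply/subcomoduleP; split=> [|g w Ow]; first exact: linspan_subspace.
apply: (Ow _ (subspace_preim (act g) (linspan_subspace _))) => _ [h ->].
by apply: linspan_mem; exists (conv g h); rewrite -act_act.
Qed.

Lemma orbit_mem M (v : M) : orbit v v.
Proof. by apply: linspan_mem; exists counit; rewrite act_counit. Qed.

Lemma orbit_spanned M (v : M) : exists n (e : 'I_n -> M), spanned_by e (orbit v).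
Proof.
pose s := repr (coact v).
exists (size s), (fun i => (tnth (in_tuple s) i).1) => w Ow.
apply: (Ow _ (combination_subspace _)) => _ [g ->].
exists (fun i => g (tnth (in_tuple s) i).2).
by rewrite /act /slicer /tens_lift big_tnth.
Qed.

Lemma orbit_sub M (v : M) (P : M -> Prop) : subcomodule P -> P v ->
  forall w, orbit v w -> P w.
Proof.
move=> /subcomoduleP[sP Pa] Pv w Ow; apply: (Ow _ sP) => _ [g ->]; exact: Pa.
Qed.

(** Among the nonzero subcomodules of P choose one, Q, spanned by the least
    possible number of vectors.  A smaller nonzero subcomodule would be spanned
    by fewer vectors, by [spanned_by_proper]. *)
Lemma exists_simple_subcomodule M (P : M -> Prop) (v : M) :
  subcomodule P -> P v -> v != 0 ->
  exists (N : comodule C) (i : {linear N -> M}),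
    [/\ simple_comodule N, colinear i, injective i & forall u, P (i u)].
Proof.
move=> sP Pv v0.
pose good n := exists (Q : M -> Prop) (e : 'I_n -> M),
  [/\ subcomodule Q, forall w, Q w -> P w, exists2 w, Q w & w != 0 & spanned_by e Q].
have exg : exists n, `[< good n >].
  have [n [e eO]] := orbit_spanned v; exists n; apply/asboolP; exists (orbit v), e.
  split=> //; [exact: orbit_subcomodule|exact: orbit_sub|].
  by exists v => //; apply: orbit_mem.
case: (ex_minnP exg) => n /asboolP [Q [e [sQ QP [w Qw w0] eQ]]] nmin.
have Qmin Q' : subcomodule Q' -> (forall x, Q' x -> Q x) ->
    (exists2 x, Q' x & x != 0) -> forall x, Q x -> Q' x.
  move=> sQ' Q'Q nzQ'; apply: contrapT => /existsNP[x /not_implyP[Qx nQ'x]].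
  have [i nQ'e] : exists i, ~ Q' (e i).
    apply: contrapT => /forallNP h; apply: nQ'x.
    have [a ->] := eQ x Qx.
    apply: (subspace_sum sQ'.1) => i.
    by apply: (subspaceZ sQ'.1); apply: contrapT; apply: h.
  case: n e eQ i nQ'e nmin => [|n] e eQ i nQ'e nmin; first by case: i {nQ'e}.
  have [|e' e'Q'] := spanned_by_proper sQ'.1 _ nQ'e.
    by move=> y /Q'Q; apply: eQ.
  have /nmin : `[< good n >].
    by apply/asboolP; exists Q', e'; split=> // y /Q'Q /QP.
  by rewrite ltnn.
have [N [i [ic ii iQ]]] := subcomodule_inclusion sQ.
exists N, i; split=> //; last by move=> u; apply: QP; apply/iQ; exists u.
split.
  have [u uE] := (iQ w).1 Qw; exists u; apply: contra_neq w0 => u0.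
  by rewrite -uE u0 linear0.
move=> R /subcomoduleP[sR Ra].
have [[u Ru u0]|nR] := pselect (exists2 u, R u & u != 0); last first.
  by left=> u Ru; apply: contrapT => /eqP u0; apply: nR; exists u.
right=> x.
have iR : subcomodule (fun y => exists2 u, R u & i u = y).
  apply/subcomoduleP; split=> [|g _ [y Ry <-]].
    split=> [|a _ _ [y Ry <-] [z Rz <-]]; first by exists 0; [exact: sR.1|exact: linear0].
    by exists (a *: y + z); [exact: sR.2|rewrite linearP].
  by exists (act g y); [exact: Ra|apply: (colinearP _).1].
have [|||z Rz /ii <- //] := Qmin _ iR _ _ (i x).
- by move=> _ [y Ry <-]; apply/iQ; exists y.
- exists (i u); first by exists u.
  by apply: contra_neq u0 => iu0; apply: ii; rewrite iu0 linear0.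
- by apply/iQ; exists x.
Qed.

Lemma simple_spanned M : simple_comodule M ->
  exists n (e : 'I_n -> M), spanned_by e (fun _ => True) /\ independent e.
Proof.
move=> [[v v0] Ms]; have [n [e eO]] := orbit_spanned v.
apply: (@exists_basis _ _ n e) => x _; apply: eO.
have [O0|] := Ms _ (orbit_subcomodule v); last exact.
by move: v0; rewrite (O0 v (@orbit_mem M v)) eqxx.
Qed.

End SimpleComodules.

(** A simple comodule is finite-dimensional, so T has an eigenvector over an
    algebraically closed field, and the eigenspace is a subcomodule. *)
Lemma schur (k : closedFieldType) (C : coalgType k) (M : comodule C) (T : {linear M -> M}) :
  simple_comodule M -> colinear T -> exists c : k, forall v, T v = c *: v.
Proof.
move=> Ms Tc; have [n [e [eM ei]]] := simple_spanned Ms.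
have [[v v0] Msub] := Ms.
case: n e eM ei => [|n] e eM ei.
  by have [a vE] := eM v I; move: v0; rewrite vE big_ord0 eqxx.
have [A AE] := choice (fun j => eM (T (e j)) I).
pose A' := \matrix_(j, i) A j i.
have /closed_rootP [c] : size (char_poly A') != 1%N by rewrite size_char_poly.
rewrite -eigenvalue_root_char => /eigenvalueP [x xA x0].
pose w := \sum_j x 0 j *: e j.
have Tw : T w = c *: w.
  rewrite /w linear_sum scaler_sumr.
  transitivity (\sum_i (x *m A') 0 i *: e i); last first.
    by apply: eq_bigr => i _; rewrite xA mxE scalerA.
  transitivity (\sum_j \sum_i (x 0 j * A j i) *: e i).
    apply: eq_bigr => j _; rewrite linearZ_LR /= AE scaler_sumr.
    by apply: eq_bigr => i _; rewrite scalerA.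
  rewrite exchange_big; apply: eq_bigr => i _ /=.
  by rewrite mxE scaler_suml; apply: eq_bigr => j _; rewrite mxE.
have w0 : w != 0.
  apply: contra_neq x0 => w0; apply/rowP => j; rewrite mxE; exact: ei w0 j.
have sker : subcomodule (fun v => T v = c *: v).
  apply/subcomoduleP; split.
    split=> [|a y z yE zE]; first by rewrite linear0 scaler0.
    by rewrite linearP yE zE scalerDr !scalerA mulrC.
  move=> g y yE; rewrite (colinearP _).1 // yE; exact: linearZ_LR.
exists c; have [w_eq0|] := Msub _ sker; last exact.
by move: w0; rewrite (w_eq0 w Tw) eqxx.
Qed.

(** * Coefficient spaces over a cosemisimple Hopf algebra *)

Section ComodIso.
Variables (k : fieldType) (C : coalgType k).
Implicit Types M N : comodule C.

Lemma comod_iso_inv M N : comod_iso M N ->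
  exists (f : {linear M -> N}) (g : {linear N -> M}),
    [/\ colinear f, colinear g, cancel f g & cancel g f].
Proof.
move=> [f fc [g0 fK g0K]].
have [g gE] : exists g : {linear N -> M}, g =1 g0.
  by apply: bundle_linear => a x y; apply: (can_inj fK); rewrite linearP !g0K.
have gK : cancel g f by move=> x; rewrite gE.
exists f, g; split=> //; last by move=> x; rewrite gE.
apply/colinearP => h v; apply: (can_inj fK).
by rewrite gK (colinearP f).1 // gK.
Qed.

Lemma comod_iso_sym M N : comod_iso M N -> comod_iso N M.
Proof. by move=> /comod_iso_inv [f [g [fc gc fK gK]]]; exists g => //; exists f. Qed.

Lemma comod_iso_trans M N (L : comodule C) :
  comod_iso M N -> comod_iso N L -> comod_iso M L.
Proof.
move=> [f /colinearP fc fb] [g /colinearP gc gb]; exists (g \o f); last exact: bij_comp.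
by apply/colinearP => h v /=; rewrite fc gc.
Qed.

Lemma coefs_iso M N c : comod_iso M N -> coefs M c -> coefs N c.
Proof.
move=> /comod_iso_inv [f [g [fc gc fK gK]]]; apply: linspan_sub => _ [h [v ->]].
exists (h \o g), (f v); rewrite /coef fc (slicel_map f idfun (h \o g)) /=.
by apply: slicel_ext => u /=; rewrite fK.
Qed.

(** i v is the coefficient of v along the functional counit after i. *)
Lemma mem_coefs M (i : {linear M -> C}) v :
  colinear (N := regular_comod C) i -> coefs M (i v).
Proof.
move=> ic; rewrite -[i v]comul_counitl.
have -> : comul (i v) = tens_map i idfun (coact v) by rewrite -ic.
rewrite (slicel_map i idfun counit); exact: coefs_mem.
Qed.

Variables (I : Type) (V : I -> comodule C).

Definition coefs_of (S : I -> Prop) : C -> Prop :=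
  linspan (fun x => exists i, S i /\ coefs (V i) x).

Lemma coefs_of_subcoalgebra S : subcoalgebra (coefs_of S).
Proof. by apply: subcoalgebra_linspan => i _; apply: coefs_subcoalgebra. Qed.

Lemma coefs_of_mem (S : I -> Prop) i c : S i -> coefs (V i) c -> coefs_of S c.
Proof. by move=> Si ci; apply: linspan_mem; exists i. Qed.

(** A simple subcoalgebra D contains a simple subcomodule of the regular comodule,
    isomorphic to some V j.  Its elements are coefficients of V j, so D meets the
    subcoalgebra of these coefficients and is contained in it. *)
Lemma coefs_of_total : cosemisimple C -> simple_classes V ->
  forall c, coefs_of (fun _ => True) c.
Proof.
move=> hC [Vs _ Vall] c; have [s [sD ->]] := hC c.
apply: (subspace_sum_seq (linspan_subspace _)) => x /sD [D [sCD [[d Dd d0] Dmin]] Dx].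
have [N [i [Ns ic ii iD]]] :=
  exists_simple_subcomodule (subcoalgebra_subcomodule sCD) Dd d0.
have [j NVj] := Vall N Ns.
have [[n n0] _] := Ns.
apply: (@coefs_of_mem _ j) => //.
have [E0|DE] := Dmin _ (subcoalgebraI sCD (coefs_subcoalgebra (V j))) (fun x => @proj1 _ _).
  case/eqP: n0; apply: ii; rewrite linear0; apply: E0; split; first exact: iD.
  by apply: coefs_iso NVj _; apply: mem_coefs.
by case: (DE x Dx).
Qed.

End ComodIso.

Section HopfCoefs.
Variables (k : fieldType) (A : hopfType k).

(** The product of two coefficients is the coefficient of x ⊗ y along f ⊗ g. *)
Lemma coefs_mul (X Y : comodule A) c d :
  coefs X c -> coefs Y d -> coefs (tens_comod X Y) (c * d).
Proof.
have sT : subspace (coefs (tens_comod X Y)) by apply: linspan_subspace.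
move=> Xc Yd.
have [m1 m1E] := bundle_linear ((mul_bilin A).1 d).
rewrite -m1E; apply: (Xc _ (subspace_preim m1 sT)) => _ [f [x ->]]; rewrite m1E.
have [m2 m2E] := bundle_linear ((mul_bilin A).2 (coef f x)).
rewrite -m2E; apply: (Yd _ (subspace_preim m2 sT)) => _ [g [y ->]]; rewrite m2E.
have fgb : bilin (fun x y => (f x : k) * g y : k^o).
  split=> [y'|x'] a u v; first by rewrite linearP mulrDl /GRing.scale /= mulrA.
  by rewrite linearP mulrDr /GRing.scale /= mulrCA.
have [fg fgE] := bundle_linear (tens_lift_linear fgb).
suff -> : coef f x * coef g y = coef (M := tens_comod X Y) fg (x ⊗ y) by apply: coefs_mem.
rewrite /coef /= tens_coact_pure.
have cb := tens_cross_bilin X Y (mul_bilin A).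
apply: (bilin_ext (f := fun u v => slicel f u * slicel g v)
  (g := fun u v => slicel fg (tens_cross (fun a b => a * b) u v))).
- by apply: (bilin_comp (mul_bilin A)); apply: linearP.
- by apply: (linear_bilin cb); apply: linearP.
move=> x0 a y0 b; rewrite (tens_cross_pure (mul_bilin A)) !slicel_pure fgE.
by rewrite (tens_lift_pure fgb) -scalerAl -scalerAr scalerA.
Qed.

Variables (B : hopfType k) (p : hopfMor A B).

Lemma coef_res (M : comodule A) (f : dual M) (v : M) :
  coef (M := res_comod p M) f v = p (coef f v).
Proof. by rewrite /coef /= (slicel_map idfun p f). Qed.

Lemma coefs_res (M : comodule A) c : coefs M c -> coefs (res_comod p M) (p c).
Proof.
move=> Mc; apply: (Mc _ (subspace_preim p (linspan_subspace _))) => _ [f [v ->]].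
have := coefs_mem (M := res_comod p M) f v; by rewrite coef_res.
Qed.

Lemma coefs_res_inv (M : comodule A) b : coefs (res_comod p M) b ->
  exists2 c, coefs M c & p c = b.
Proof.
move=> Mb; apply: (Mb (fun b => exists2 c, coefs M c & p c = b)).
  have sM : subspace (coefs M) by apply: linspan_subspace.
  split=> [|a _ _ [c Mc <-] [d Md <-]]; first by exists 0; [exact: sM.1|rewrite linear0].
  by exists (a *: c + d); [exact: sM.2|rewrite linearP].
move=> _ [f [v ->]]; exists (coef (M := M) f v); first exact: (coefs_mem (M := M)).
by rewrite coef_res.
Qed.

Lemma hom_nonzero_res (M N : comodule A) :
  hom_nonzero M N -> hom_nonzero (res_comod p M) (res_comod p N).
Proof.
move=> [f fc fnz]; exists f => // v; rewrite /= /res_coact /= fc !tens_map_comp.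
exact: eq_tens_map.
Qed.

(** A is the sum of N, spanned by the coefficients of the V m with a nonzero map to
    X, and of the analogous N' for the other m; by orthogonality the coefficients
    of X meet N' in 0.  For c a coefficient of X and f a functional killing N, the
    element f(c_1) c_2 is both a coefficient of X and in N', hence is 0, and
    applying the counit gives f(c) = 0. *)
Lemma coefs_decomposition (I : Type) (V : I -> comodule A) (X : comodule A) :
  cosemisimple A -> simple_classes V ->
  forall c, coefs X c -> coefs_of V (fun m => hom_nonzero (V m) X) c.
Proof.
move=> hA hV; have [l hl] := exists_integral hA.
pose S m := hom_nonzero (V m) X.
pose N := coefs_of V S; pose N' := coefs_of V (fun m => ~ S m).
have sN : subcoalgebra N by apply: coefs_of_subcoalgebra.
have sN' : subcoalgebra N' by apply: coefs_of_subcoalgebra.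
have XN' x : coefs X x -> N' x -> x = 0.
  apply: (orthogonal_disjoint hl) => //; first exact: coefs_subcoalgebra.
  move=> d e Xd N'e.
  have lb : linear (fun e : A => l (d * antipode e)).
    by move=> a u v; rewrite linearP mulrDr -scalerAr linearP.
  have [l1 l1E] := bundle_linear lb.
  rewrite -[LHS]l1E; apply: (N'e _ (subspace_ker l1)) => e' [m [nSm Vm]]; rewrite l1E.
  exact: orthogonality hl _ _ nSm _ _ Vm Xd.
move=> c Xc; apply: (subspace_dualP sN.1) => f fN.
suff y0 : slicel f (comul c) = 0.
  by rewrite -[c]comul_counitr -slice_comm y0 linear0.
apply: XN'; first exact: (((subcoalgebraP _).1 (coefs_subcoalgebra X)).2 c Xc).1.
apply: (coefs_of_total hA hV c (subspace_preim (slicel f \o comul) sN'.1)) => x [m [_ Vm]] /=.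
have [Sm|nSm] := pselect (S m).
  have Nx : N x by exact: (coefs_of_mem (V := V) (S := S) Sm Vm).
  by rewrite (tens_in_slicel (sN.2 x Nx) fN); apply: sN'.1.1.
have N'x : N' x by exact: (coefs_of_mem (V := V) (S := fun m => ~ S m) nSm Vm).
exact: (((subcoalgebraP _).1 sN').2 x N'x).1.
Qed.

End HopfCoefs.

(** * The group algebra *)

Section GroupAlgebra.
Import freeg.
Variables (k : fieldType) (G : groupType).

Definition group_algebra : Type := {freeg G / k}.
HB.instance Definition _ := GRing.Zmodule.copy group_algebra {freeg G / k}.
HB.instance Definition _ := GRing.Zmodule_isLmodule.Build k group_algebra
  (@fgscaleA k G) (@fgscale1r k G) (@fgscaleDr k G) (@fgscaleDl k G).
Local Notation kG := group_algebra.

Definition delta (g : G) : kG := << g >>.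
Definition coefficient (g : G) (x : kG) : k := coeff g x.

Lemma group_algebra_sum (x : kG) : x = \sum_(g <- dom x) coefficient g x *: delta g.
Proof.
rewrite -{1}[x]freeg_sumE; apply: eq_bigr => g _.
apply/eqP/freeg_eqP => h; rewrite coeffZ /delta !coeffU mul1r; congr (_ * _).
Qed.

Lemma coefficient_delta g h : coefficient g (delta h) = (g == h)%:R.
Proof. by rewrite /coefficient /delta coeffU mul1r eq_sym. Qed.

Lemma coefficient_linear g : linear (coefficient g : kG -> k^o).
Proof. by move=> a x y; rewrite /coefficient coeffD coeffZ. Qed.

HB.instance Definition _ g :=
  GRing.isLinear.Build k kG k^o *:%R (coefficient g) (coefficient_linear g).

Lemma coefficient0 g : coefficient g 0 = 0.
Proof. exact: (linear0 (coefficient g)). Qed.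

Lemma coefficientP g a x y :
  coefficient g (a *: x + y) = a * coefficient g x + coefficient g y.
Proof. exact: coefficient_linear. Qed.

Lemma coefficientZ g a x : coefficient g (a *: x) = a * coefficient g x.
Proof. by rewrite -[a *: x]addr0 coefficientP coefficient0 addr0. Qed.

Lemma coefficient_inj (x y : kG) : coefficient^~ x =1 coefficient^~ y -> x = y.
Proof. by move=> xy; apply/eqP/freeg_eqP. Qed.

Lemma group_algebra_ext (M : lmodType k) (f h : {linear kG -> M}) :
  (forall g, f (delta g) = h (delta g)) -> f =1 h.
Proof.
move=> fh x; rewrite [x]group_algebra_sum !linear_sum; apply: eq_bigr => g _.
by rewrite !linearZ_LR /= fh.
Qed.

Definition linearize (M : lmodType k) (f : G -> M) (x : kG) : M := fglift f x.

Lemma linearize_delta (M : lmodType k) (f : G -> M) g : linearize f (delta g) = f g.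
Proof. by rewrite /linearize /delta liftU scale1r. Qed.

Lemma linearizeD (M : lmodType k) (f : G -> M) (x y : kG) :
  linearize f (x + y) = linearize f x + linearize f y.
Proof.
have lB (u v : kG) : linearize f (u - v) = linearize f u - linearize f v.
  exact: lift_is_additive.
have l0 : linearize f 0 = 0 by rewrite -(subrr 0) lB subrr.
have lN u : linearize f (- u) = - linearize f u by rewrite -sub0r lB l0 sub0r.
by rewrite -{1}[y]opprK lB lN opprK.
Qed.

Lemma linearize_linear (M : lmodType k) (f : G -> M) : linear (linearize f).
Proof.
have lZ (c : k) g : linearize f (c *: delta g) = c *: f g.
  rewrite /linearize -(liftU f); congr fglift.
  by apply/eqP/freeg_eqP => h; rewrite coeffZ /delta !coeffU mul1r.
have l0 : linearize f 0 = 0 by apply: (@addrI _ (linearize f 0)); rewrite -linearizeD !addr0.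
have lZZ (a : k) (x : kG) : linearize f (a *: x) = a *: linearize f x.
  pose P (u : kG) := linearize f (a *: u) = a *: linearize f u.
  have P0 : P 0 by rewrite /P scaler0 l0 scaler0.
  have PD u v : P u -> P v -> P (u + v).
    by rewrite /P => hu hv; rewrite scalerDr !linearizeD hu hv scalerDr.
  have PZ c g : P (c *: delta g) by rewrite /P scalerA !lZ scalerA.
  rewrite -[_ = _]/(P x) [x]group_algebra_sum; elim/big_ind: _ => [|u v|g _].
  - exact: P0.
  - exact: PD.
  exact: PZ.
by move=> a x y; rewrite linearizeD lZZ.
Qed.

HB.instance Definition _ (M : lmodType k) (f : G -> M) :=
  GRing.isLinear.Build k kG M *:%R (linearize f) (linearize_linear f).

Lemma linearizeE (M : lmodType k) (f : G -> M) x :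
  linearize f x = \sum_(g <- dom x) coefficient g x *: f g.
Proof.
rewrite {1}[x]group_algebra_sum linear_sum; apply: eq_bigr => g _.
by rewrite linearZ_LR /= linearize_delta.
Qed.

Lemma bilin_group_algebra_ext (M : lmodType k) (f h : kG -> kG -> M) :
  bilin f -> bilin h -> (forall a b, f (delta a) (delta b) = h (delta a) (delta b)) ->
  f =2 h.
Proof.
move=> fb hb fh x y.
have [f1 f1E] := bundle_linear (fb.1 y); have [h1 h1E] := bundle_linear (hb.1 y).
rewrite -[LHS]f1E -[RHS]h1E; apply: group_algebra_ext => a; rewrite f1E h1E.
have [f2 f2E] := bundle_linear (fb.2 (delta a)); have [h2 h2E] := bundle_linear (hb.2 (delta a)).
by rewrite -f2E -h2E; apply: group_algebra_ext => b; rewrite f2E h2E.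
Qed.

Definition gmul (x y : kG) : kG :=
  linearize (fun g => linearize (fun h => delta (g * h)%g) y) x.

Lemma gmul_bilin : bilin gmul.
Proof.
split=> [y|x]; first exact: linearize_linear.
move=> a y z; rewrite /gmul !linearizeE scaler_sumr -big_split /=.
by apply: eq_bigr => g _; rewrite linearP scalerDr !scalerA mulrC.
Qed.

Lemma gmul_delta g h : gmul (delta g) (delta h) = delta (g * h)%g.
Proof. by rewrite /gmul !linearize_delta. Qed.

Lemma gmulDl : left_distributive gmul +%R.
Proof. by move=> x y z; rewrite -[x]scale1r gmul_bilin.1 !scale1r. Qed.

Lemma gmulDr : right_distributive gmul +%R.
Proof. by move=> x y z; rewrite -[y]scale1r gmul_bilin.2 !scale1r. Qed.

Lemma gmul0l x : gmul 0 x = 0.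
Proof. by apply: (@addrI _ (gmul 0 x)); rewrite -gmulDl !addr0. Qed.

Lemma gmul0r x : gmul x 0 = 0.
Proof. by apply: (@addrI _ (gmul x 0)); rewrite -gmulDr !addr0. Qed.

Lemma gmulZl a x y : a *: gmul x y = gmul (a *: x) y.
Proof. by rewrite -[a *: x]addr0 gmul_bilin.1 gmul0l addr0. Qed.

Lemma gmulZr a x y : a *: gmul x y = gmul x (a *: y).
Proof. by rewrite -[a *: y]addr0 gmul_bilin.2 gmul0r addr0. Qed.

Lemma gmulA : associative gmul.
Proof.
move=> x y z.
have [l lE] := bundle_linear (gmul_bilin.2 x).
have [r rE] := bundle_linear (gmul_bilin.1 z).
pose f y := gmul x (gmul y z); pose h y := gmul (gmul x y) z.
have [f' f'E] : exists f' : {linear kG -> kG}, f' =1 f.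
  by apply: bundle_linear => a u v; rewrite /f gmul_bilin.1 gmul_bilin.2.
have [h' h'E] : exists h' : {linear kG -> kG}, h' =1 h.
  by apply: bundle_linear => a u v; rewrite /h gmul_bilin.2 gmul_bilin.1.
rewrite -/(f y) -/(h y) -f'E -h'E; apply: group_algebra_ext => b; rewrite f'E h'E.
apply: (bilin_group_algebra_ext (f := fun x z => gmul x (gmul (delta b) z))
  (h := fun x z => gmul (gmul x (delta b)) z)).
- by split=> [v|u] a s t; rewrite ?gmul_bilin.1 // !gmul_bilin.2.
- by split=> [v|u] a s t; rewrite ?gmul_bilin.2 // !gmul_bilin.1.
by move=> a c; rewrite !gmul_delta mulgA.
Qed.

Lemma gmul1l : left_id (delta 1%g) gmul.
Proof.
move=> x; have [f fE] := bundle_linear (gmul_bilin.2 (delta 1%g)).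
rewrite -fE; apply: (group_algebra_ext (h := idfun)) => g.
by rewrite fE gmul_delta mul1g.
Qed.

Lemma gmul1r : right_id (delta 1%g) gmul.
Proof.
move=> x; have [f fE] := bundle_linear (gmul_bilin.1 (delta 1%g)).
rewrite -[LHS]fE; apply: (group_algebra_ext (h := idfun)) => g.
by rewrite fE gmul_delta mulg1.
Qed.

Lemma delta_neq0 g : delta g != 0.
Proof.
apply/eqP => /(congr1 (coefficient g)); rewrite coefficient_delta eqxx linear0.
by move/eqP; rewrite oner_eq0.
Qed.

HB.instance Definition _ := GRing.Zmodule_isNzRing.Build kG
  gmulA gmul1l gmul1r gmulDl gmulDr (delta_neq0 1%g).
HB.instance Definition _ := GRing.Lmodule_isLalgebra.Build k kG gmulZl.
HB.instance Definition _ := GRing.Lalgebra_isAlgebra.Build k kG gmulZr.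

Lemma deltaM g h : delta g * delta h = delta (g * h)%g.
Proof. exact: gmul_delta. Qed.

Lemma delta1 : delta 1%g = 1.
Proof. by []. Qed.

Definition gcomul : {linear kG -> tensor kG kG} := linearize (fun g => delta g ⊗ delta g).
Definition gcounit : {linear kG -> k^o} := linearize (fun _ => 1 : k^o).
Definition gantipode : {linear kG -> kG} := linearize (fun g => delta g^-1%g).

Lemma gcomul_delta g : gcomul (delta g) = delta g ⊗ delta g.
Proof. exact: linearize_delta. Qed.

Lemma gcounit_delta g : gcounit (delta g) = 1.
Proof. exact: linearize_delta. Qed.

Lemma gantipode_delta g : gantipode (delta g) = delta g^-1%g.
Proof. exact: linearize_delta. Qed.

Lemma gcomulA (x : kG) :
  tens_assoc (tens_map gcomul idfun (gcomul x)) = tens_map idfun gcomul (gcomul x).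
Proof.
apply: (group_algebra_ext (f := @tens_assoc _ _ _ _ \o tens_map gcomul idfun \o gcomul)
  (h := tens_map idfun gcomul \o gcomul)) => g /=.
rewrite gcomul_delta (tens_map_pure gcomul idfun) (tens_map_pure idfun gcomul).
by rewrite gcomul_delta tens_assoc_pure.
Qed.

Lemma gcounitl (x : kG) :
  tens_lift (fun (x : kG) (y : kG) => (gcounit x : k) *: y) (gcomul x) = x.
Proof.
apply: (group_algebra_ext (f := slicel gcounit \o gcomul) (h := idfun)) => g /=.
by rewrite gcomul_delta slicel_pure gcounit_delta scale1r.
Qed.

Lemma gcounitr (x : kG) :
  tens_lift (fun (x : kG) (y : kG) => (gcounit y : k) *: x) (gcomul x) = x.
Proof.
apply: (group_algebra_ext (f := slicer gcounit \o gcomul) (h := idfun)) => g /=.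
by rewrite gcomul_delta slicer_pure gcounit_delta scale1r.
Qed.

HB.instance Definition _ := isCoalgebra.Build k kG gcomulA gcounitl gcounitr.

Lemma gcomulM (x y : kG) : gcomul (x * y) = tens_mul (gcomul x) (gcomul y).
Proof.
apply: (bilin_group_algebra_ext (f := fun x y => gcomul (x * y))
  (h := fun x y => tens_mul (gcomul x) (gcomul y))).
- by apply: (linear_bilin (l := gcomul) (mul_bilin kG)); apply: linearP.
- by apply: (bilin_comp (f := gcomul) (g := gcomul) (tens_mul_bilin kG)); apply: linearP.
by move=> a b; rewrite deltaM !gcomul_delta tens_mul_pure !deltaM.
Qed.

Lemma gcounitM (x y : kG) : (gcounit (x * y) : k) = gcounit x * gcounit y.
Proof.
apply: (bilin_group_algebra_ext (f := fun x y => gcounit (x * y))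
  (h := fun x y => (gcounit x : k) * gcounit y : k^o)).
- by apply: (linear_bilin (l := gcounit) (mul_bilin kG)); apply: linearP.
- split=> [u|u] a v w; rewrite linearP ?mulrDl ?mulrDr /GRing.scale /= ?mulrA //.
  by rewrite [_ * a]mulrC.
by move=> a b; rewrite deltaM !gcounit_delta mulr1.
Qed.

Lemma gantipodel (x : kG) :
  tens_lift (fun a b => gantipode a * b) (gcomul x) = (gcounit x : k) *: 1.
Proof.
have bl : bilin (fun a b => gantipode a * b).
  by apply: (bilin_comp (f := gantipode) (g := idfun) (mul_bilin kG)) => //; apply: linearP.
have [f fE] := bundle_linear (tens_lift_linear bl).
rewrite -fE.
have [u uE] : exists u : {linear kG -> kG}, u =1 (fun x => (gcounit x : k) *: 1).
  by apply: bundle_linear => a y z; rewrite linearP scalerDl scalerA.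
rewrite -uE; apply: (group_algebra_ext (f := f \o gcomul)) => g.
rewrite /= fE uE gcomul_delta (tens_lift_pure bl) gantipode_delta deltaM mulVg.
by rewrite gcounit_delta scale1r.
Qed.

Lemma gantipoder (x : kG) :
  tens_lift (fun a b => a * gantipode b) (gcomul x) = (gcounit x : k) *: 1.
Proof.
have bl : bilin (fun a b => a * gantipode b).
  by apply: (bilin_comp (f := idfun) (g := gantipode) (mul_bilin kG)) => //; apply: linearP.
have [f fE] := bundle_linear (tens_lift_linear bl).
rewrite -fE.
have [u uE] : exists u : {linear kG -> kG}, u =1 (fun x => (gcounit x : k) *: 1).
  by apply: bundle_linear => a y z; rewrite linearP scalerDl scalerA.
rewrite -uE; apply: (group_algebra_ext (f := f \o gcomul)) => g.
rewrite /= fE uE gcomul_delta (tens_lift_pure bl) gantipode_delta deltaM mulgV.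
by rewrite gcounit_delta scale1r.
Qed.

HB.instance Definition _ := isHopf.Build k kG (gcomul_delta 1%g) gcomulM
  (gcounit_delta 1%g) gcounitM gantipodel gantipoder.

End GroupAlgebra.

(** * Comodules on which the coaction is scalar *)

Section Grouplike.
Variables (k : fieldType) (C : coalgType k) (r : C).
Hypotheses (comul_r : comul r = r ⊗ r) (counit_r : counit r = 1).

Definition grouplike_coact (a : k^o) : tensor k^o C := a ⊗ r.

Lemma grouplike_coact_linear : linear grouplike_coact.
Proof. by move=> a x y; rewrite /grouplike_coact (pure_bilin _ _).1. Qed.

HB.instance Definition _ :=
  GRing.isLinear.Build k k^o (tensor k^o C) *:%R grouplike_coact grouplike_coact_linear.

Lemma grouplike_coactA a :
  tens_assoc (tens_map grouplike_coact idfun (grouplike_coact a))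
  = tens_map idfun comul (grouplike_coact a).
Proof. by rewrite (tens_map_pure grouplike_coact idfun) tens_map_pure comul_r tens_assoc_pure. Qed.

Lemma grouplike_coact_counit a :
  tens_lift (fun (w : k^o : lmodType k) (c : C) => counit c *: w) (grouplike_coact a) = a.
Proof. by rewrite (tens_lift_pure (counit_bilin C _)) counit_r scale1r. Qed.

Definition grouplike_comod : comodule C :=
  Comodule grouplike_coactA grouplike_coact_counit.

Lemma grouplike_simple : simple_comodule grouplike_comod.
Proof.
split; first by exists (1 : k^o); apply: oner_neq0.
move=> P [sP _]; have [[a Pa a0]|n0] := pselect (exists2 a, P a & a != 0).
  right=> b; have -> : b = (b / a : k) *: a by rewrite /GRing.scale /= divfK.
  exact: subspaceZ.
by left=> a Pa; apply: contrapT => /eqP a0; apply: n0; exists a.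
Qed.

(** A simple comodule is spanned by any nonzero vector on which the coaction is
    scalar. *)
Lemma grouplike_iso (M : comodule C) (m : M) :
  simple_comodule M -> m != 0 -> coact m = m ⊗ r -> comod_iso grouplike_comod M.
Proof.
move=> [_ Msub] m0 mr.
have [f fE] : exists f : {linear k^o -> M}, f =1 (fun a : k^o => (a : k) *: m).
  by apply: bundle_linear => a x y; rewrite scalerDl scalerA.
have fi : injective f.
  move=> a b; rewrite !fE => /eqP; rewrite -subr_eq0 -scalerBl scaler_eq0 (negPf m0) orbF.
  by rewrite subr_eq0 => /eqP.
have [||h] := Msub (fun v => exists a, f a = v).
- apply/subcomoduleP; split.
    split=> [|a _ _ [x <-] [y <-]]; first by exists 0; rewrite linear0.
    by exists (a *: x + y); rewrite linearP.
  move=> g _ [a <-]; exists (a * g r); rewrite !fE linearZ_LR /= /act mr slicer_pure.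
  by rewrite scalerA.
- move=> /(_ m) h; case/eqP: m0; apply: h.
  by exists 1; rewrite fE scale1r.
have [f1 f1K] := choice h.
exists f; last by exists f1 => // a; apply: fi; rewrite f1K.
by move=> a; rewrite fE linearZ_LR /= mr (tens_map_pure f idfun) fE pureZl.
Qed.

End Grouplike.

Lemma grouplike_iso_eq (k : fieldType) (C : coalgType k) (r s : C)
  (hr : comul r = r ⊗ r) (er : counit r = 1) (hs : comul s = s ⊗ s) (es : counit s = 1) :
  comod_iso (grouplike_comod hr er) (grouplike_comod hs es) -> r = s.
Proof.
move=> [f fc [g fK gK]].
have := fc (1 : k^o); rewrite /= /grouplike_coact (tens_map_pure f idfun) => E.
have /eqP f1 : f 1 != 0.
  by apply/eqP => f1; move: (fK 1); rewrite f1 -(linear0 f) fK => /esym/eqP; rewrite oner_eq0.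
have [h [_ h1]] := separation (subspace_zero k^o) f1.
by have := congr1 (slicel h) E; rewrite !slicel_pure h1 !scale1r.
Qed.

Section Scalar.
Variables (k : fieldType) (C : coalgType k) (M : comodule C) (r : C).
Hypothesis Mr : forall v : M, coact v = v ⊗ r.

Lemma scalar_coef (f : dual M) v : coef f v = (f v : k) *: r.
Proof. by rewrite /coef Mr slicel_pure. Qed.

(** r is the coefficient of v along any f with f(v) = 1. *)
Lemma scalar_grouplike (v : M) : v != 0 -> comul r = r ⊗ r /\ counit r = 1.
Proof.
move=> /eqP v0; have [f [_ f1]] := separation (subspace_zero M) v0.
have rE : coef f v = r by rewrite scalar_coef f1 scale1r.
split; last by rewrite -rE counit_coef.
by rewrite -{1}rE comul_coef Mr (tens_map_pure (coef f) idfun) /= rE.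
Qed.

End Scalar.

Lemma grouplike_eq_iso (k : fieldType) (C : coalgType k) (r s : C)
  (hr : comul r = r ⊗ r) (er : counit r = 1) (hs : comul s = s ⊗ s) (es : counit s = 1) :
  r = s -> comod_iso (grouplike_comod hr er) (grouplike_comod hs es).
Proof.
move=> rs; exists idfun; last by exists idfun.
by move=> a; rewrite /= /grouplike_coact (tens_map_pure idfun idfun) rs.
Qed.

Lemma scalar_iso (k : fieldType) (C : coalgType k) (M : comodule C) (r : C)
  (hr : comul r = r ⊗ r) (er : counit r = 1) :
  comod_iso (grouplike_comod hr er) M -> forall v : M, coact v = v ⊗ r.
Proof.
move=> /comod_iso_inv [f [g [fc _ _ gK]]] v.
by rewrite -[v]gK fc /= /grouplike_coact (tens_map_pure f idfun).
Qed.

Lemma scalar_colinear (k : fieldType) (C : coalgType k) (M N : comodule C) (r : C)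
  (f : {linear M -> N}) : (forall v : M, coact v = v ⊗ r) ->
  (forall v : N, coact v = v ⊗ r) -> colinear f.
Proof. by move=> Mr Nr v; rewrite Mr Nr (tens_map_pure f idfun). Qed.

(** Linear maps between comodules with the same scalar coaction are colinear, so a
    basis of M is all that is needed. *)
Lemma scalar_sum_of_copies (k : fieldType) (C : coalgType k) (M N : comodule C) (r : C)
  (hr : comul r = r ⊗ r) (er : counit r = 1) n (e : 'I_n -> M) :
  (forall v : M, coact v = v ⊗ r) -> spanned_by e (fun _ => True) -> independent e ->
  comod_iso (grouplike_comod hr er) N -> sum_of_copies M N.
Proof.
move=> Mr eM ei NK; have Nr := scalar_iso NK.
have [f [g [_ _ fK gK]]] := comod_iso_inv NK.
have Fex a : exists F : {linear N -> M}, F =1 (fun u => (g u : k) *: e a).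
  by apply: bundle_linear => b x y; rewrite linearP scalerDl scalerA.
have [F FE] := choice Fex.
exists n, F; split=> [a|]; first exact: scalar_colinear Mr.
have [c cE] := choice (fun v => eM v I).
pose coord v : {ffun 'I_n -> N} := [ffun a => f (c v a)].
exists coord => [w|v]; last first.
  rewrite [RHS]cE; apply: eq_bigr => a _.
  by rewrite FE ffunE fK.
apply/ffunP => a; rewrite ffunE; set v := \sum_i _.
have := ei (fun a => c v a - g (w a)).
rewrite (eq_bigr (fun a => c v a *: e a - (g (w a) : k) *: e a)); last first.
  by move=> b _; rewrite scalerBl.
rewrite sumrB -cE /v (eq_bigr _ (fun b _ => FE b (w b))) subrr => /(_ erefl a)/subr0_eq ->.
exact: gK.
Qed.

Lemma scalar_tensor (k : fieldType) (A : hopfType k) (X Y : comodule A) (r s : A) :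
  (forall v : X, coact v = v ⊗ r) -> (forall v : Y, coact v = v ⊗ s) ->
  forall z : tens_comod X Y, coact z = z ⊗ (r * s).
Proof.
move=> Xr Ys z; have [p pE] := bundle_linear ((pure_bilin (tensor X Y) A).1 (r * s)).
rewrite -pE; move: z; apply: (tens_linear_ext (f := @tens_coact k A X Y) (g := p)) => x y.
by rewrite pE [LHS]tens_coact_pure Xr Ys (tens_cross_pure (mul_bilin A)).
Qed.

Lemma grouplike_tensor_iso (k : fieldType) (A : hopfType k) (X Y N : comodule A) (r s t : A)
  (hr : comul r = r ⊗ r) (er : counit r = 1) (hs : comul s = s ⊗ s) (es : counit s = 1)
  (ht : comul t = t ⊗ t) (et : counit t = 1) :
  comod_iso (grouplike_comod hr er) X -> comod_iso (grouplike_comod hs es) Y ->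
  comod_iso (grouplike_comod ht et) N -> t = r * s -> comod_iso N (tens_comod X Y).
Proof.
move=> XK YK NK trs.
have Nr := scalar_iso NK; have XYr := scalar_tensor (scalar_iso XK) (scalar_iso YK).
have [f1 [g1 [_ _ fK1 gK1]]] := comod_iso_inv XK.
have [f2 [g2 [_ _ fK2 gK2]]] := comod_iso_inv YK.
have [f3 [g3 [_ _ fK3 gK3]]] := comod_iso_inv NK.
pose w := f1 (1 : k^o) ⊗ f2 (1 : k^o).
have [F FE] : exists F : {linear N -> tensor X Y}, F =1 (fun u => (g3 u : k) *: w).
  by apply: bundle_linear => b x y; rewrite linearP scalerDl scalerA.
have lb : bilin (fun (x : X) (y : Y) => (g1 x : k) * g2 y : k^o).
  split=> [y|x] a u v; first by rewrite linearP mulrDl /GRing.scale /= mulrA.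
  by rewrite linearP mulrDr /GRing.scale /= mulrCA.
have [l lE] := bundle_linear (tens_lift_linear lb).
exists (F : {linear N -> tens_comod X Y}).
  by apply: (scalar_colinear (r := t)) => //; rewrite trs.
exists (f3 \o l) => [u|x].
  rewrite /= FE linearZ_LR /= lE /w (tens_lift_pure lb) fK1 fK2 mulr1.
  by rewrite /GRing.scale /= mulr1 gK3.
rewrite /= FE fK3.
have [h hE] : exists h : {linear tensor X Y -> tensor X Y}, h =1 (fun x => (l x : k) *: w).
  by apply: bundle_linear => b y z; rewrite linearP scalerDl scalerA.
rewrite -hE; apply: (tens_linear_ext (g := idfun)) => u v; rewrite hE lE (tens_lift_pure lb) /w.
by rewrite -scalerA -pureZr -pureZl -!linearZ_LR /= /GRing.scale /= !mulr1 gK1 gK2.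
Qed.

Section CentralCharacter.
Variables (k : closedFieldType) (A R : hopfType k) (rho : hopfMor A R).
Hypothesis rho_central : hopf_central rho.

(** For a functional h of R, the operator v |-> h(rho(v_1)) v_0 is colinear because
    rho is central, so it is a scalar by Schur's lemma.  As functionals separate
    the points of R, these scalars are the values of h at a single element r. *)
Lemma central_scalar (M : comodule A) : simple_comodule M ->
  exists r : R, forall v, coact (c := res_comod rho M) v = v ⊗ r.
Proof.
move=> Ms; have [[v0 v0nz] _] := Ms.
have T (h : dual R) : exists c : k, forall v : M, act (h \o rho : dual A) v = c *: v.
  apply: (schur (T := act (h \o rho : dual A)) Ms).
  apply/colinearP => g v; rewrite /= !act_act /act /slicer; apply: eq_tens_lift => w a.
  congr (_ *: _).
  rewrite /conv /= -[LHS]/((h \o rho : dual A) _) -slice_comm; congr (g _).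
  transitivity (slicel h (tens_map rho idfun (comul a))).
    exact/esym/(slicel_map rho idfun h).
  by rewrite rho_central (slicel_map rho idfun h) /= slicel_swap.
have v0nz' : v0 <> 0 by apply/eqP.
have [f [_ f1]] := separation (subspace_zero M) v0nz'.
exists (coef (M := res_comod rho M) f v0) => v.
apply: slicer_inj => h; have [c cE] := T h.
rewrite slicer_pure act_coef /act /= !(slicer_map idfun rho h) /=.
rewrite -!/(act (h \o rho : dual A) _) !cE linearZ_LR /= f1.
by rewrite /GRing.scale /= mulr1.
Qed.

Lemma res_scalar_tensor (X Y : comodule A) (r s : R) :
  (forall v, coact (c := res_comod rho X) v = v ⊗ r) ->
  (forall v, coact (c := res_comod rho Y) v = v ⊗ s) ->
  forall z, coact (c := res_comod rho (tens_comod X Y)) z = z ⊗ (r * s).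
Proof.
move=> Xr Ys z.
have [p pE] := bundle_linear ((pure_bilin (tensor X Y) R).1 (r * s)).
rewrite -pE; move: z.
apply: (tens_linear_ext (f := tens_map idfun rho \o @tens_coact k A X Y) (g := p)) => x y /=.
rewrite pE tens_coact_pure.
transitivity (tens_cross (fun a b : R => a * b) (coact (c := res_comod rho X) x)
   (coact (c := res_comod rho Y) y)); last first.
  by rewrite Xr Ys (tens_cross_pure (mul_bilin R)).
have cA := tens_cross_bilin X Y (mul_bilin A).
have cR := tens_cross_bilin X Y (mul_bilin R).
apply: (bilin_ext (f := fun u v => tens_map idfun rho (tens_cross (fun a b : A => a * b) u v))
  (g := fun u v => tens_cross (fun a b : R => a * b) (tens_map idfun rho u)
    (tens_map idfun rho v))).
- by apply: (linear_bilin cA); apply: linearP.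
- by apply: (bilin_comp cR); apply: linearP.
move=> u a v b; rewrite !(tens_map_pure idfun rho) !tens_cross_pure; try exact: mul_bilin.
by rewrite (tens_map_pure idfun rho) rmorphM.
Qed.

End CentralCharacter.

(** * The grading by the chain group *)

Section ChainGrading.
Variables (k : fieldType) (A B : hopfType k) (piH : hopfMor A B).
Hypotheses (hA : cosemisimple A) (hB : cosemisimple B).
Variables (I : choiceType) (V : I -> comodule A) (hV : simple_classes V).

Local Notation G := (chain_group piH V).
Local Notation gen := (chain_gen piH V).

Lemma chain_gen_mul u v w :
  hom_nonzero (res_comod piH (V u)) (res_comod piH (tens_comod (V v) (V w))) ->
  gen u = (gen v * gen w)%g.
Proof.
move=> h; have -> : (gen v * gen w)%g = pmul (gen v) (gen w) by [].
by rewrite /chain_gen /pres_gen pmulE; apply/word_classP/word_eq_rel; exists u, v, w.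
Qed.

(** The trivial comodule is some V i, and by orthogonality there is a nonzero
    B-colinear map from V i to V i ⊗ V i, since λ(1 S(1)) = λ(1) = 1.  Hence the
    generator of V i is equal to its square. *)
Lemma unit_index : exists i, coefs (V i) 1 /\ gen i = 1%g.
Proof.
have one_one : comul (1 : A) = 1 ⊗ 1 by apply: comul1.
have e1 : counit (1 : A) = 1 by apply: counit1.
have [_ _ Vall] := hV.
have [i iso1] := Vall _ (grouplike_simple one_one e1).
have c1 : coefs (V i) 1.
  apply: coefs_iso iso1 _.
  have [f fE] := @bundle_linear k k^o k^o idfun (fun a x y => erefl).
  have cE : coef (M := grouplike_comod one_one e1) f (1 : k^o) = 1.
    by rewrite (scalar_coef (r := 1)) // fE scale1r.
  by rewrite -[X in coefs _ X]cE; apply: coefs_mem.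
exists i; split=> //.
have [l hl] := exists_integral hB.
apply: (@mulgI _ (gen i)); rewrite mulg1; apply/esym/chain_gen_mul.
apply: contrapT => nh.
have cB1 : coefs (res_comod piH (V i)) 1 by rewrite -(rmorph1 piH); apply: coefs_res.
have cB2 : coefs (res_comod piH (tens_comod (V i) (V i))) 1.
  have -> : (1 : B) = piH (1 * 1) by rewrite mulr1 rmorph1.
  by apply: coefs_res; apply: coefs_mul.
have /eqP := orthogonality hl nh cB1 cB2.
have -> : antipode (1 : B) = 1.
  have := antipodel (1 : B).
  have mb : bilin (fun a b : B => antipode a * b).
    by apply: (bilin_comp (f := antipode) (g := idfun) (mul_bilin B)) => //; apply: linearP.
  by rewrite comul1 (tens_lift_pure mb) mulr1 counit1 scale1r.
by rewrite mulr1 hl.1 oner_eq0.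
Qed.

(** A nonzero B-colinear map from V i to V j ⊗ V u, with V u trivial, would give
    gen i = gen j. *)
Lemma chain_orthogonality i j :
  gen i <> gen j -> forall c d, coefs (V i) c -> coefs (V j) d ->
  forall l, invariant_integral l -> (l (piH d * antipode (piH c)) : k) = 0.
Proof.
move=> gij c d Vc Vd l hl; have [u [u1 gu]] := unit_index.
have nh : ~ hom_nonzero (res_comod piH (V i)) (res_comod piH (tens_comod (V j) (V u))).
  by move=> /chain_gen_mul; rewrite gu mulg1.
apply: (orthogonality hl nh); first exact: coefs_res.
by rewrite -[d]mulr1; apply: coefs_res; apply: coefs_mul.
Qed.

(** By orthogonality the images in B of the coefficients of degree g and of those
    of the other degrees meet in 0, so there is a functional equal to the counit
    on the former and 0 on the latter. *)
Lemma exists_degree_functional (g : G) : exists e : dual B,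
  forall i c, coefs (V i) c -> e (piH c) = (gen i == g)%:R * counit c.
Proof.
have [l hl] := exists_integral hB.
pose W i := res_comod piH (V i).
pose P := coefs_of W (fun i => gen i = g); pose N := coefs_of W (fun i => gen i <> g).
have sP : subcoalgebra P by apply: coefs_of_subcoalgebra.
have sN : subcoalgebra N by apply: coefs_of_subcoalgebra.
have NP x : N x -> P x -> x = 0.
  apply: (orthogonal_disjoint hl) => // d e Nd Pe.
  have lb : bilin (fun d e : B => l (d * antipode e)).
    split=> [z|x'] a u v; first by rewrite mulrDl -scalerAl linearP.
    by rewrite linearP mulrDr -scalerAr linearP.
  have [l1 l1E] := bundle_linear (lb.1 e).
  rewrite -[LHS]l1E; apply: (Nd _ (subspace_ker l1)) => b [j [gj Vj]]; rewrite l1E.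
  have [l2 l2E] := bundle_linear (lb.2 b).
  rewrite -[LHS]l2E; apply: (Pe _ (subspace_ker l2)) => b' [i [gi Vi]]; rewrite l2E.
  have [d' Vd' <-] := coefs_res_inv Vj; have [c' Vc' <-] := coefs_res_inv Vi.
  by apply: (chain_orthogonality _ Vc' Vd' hl); rewrite gi; apply/nesym.
have [e [eP eN]] := extend_functional (f := counit) sP.1 sN.1
  (fun x Px Nx => etrans (congr1 counit (NP x Nx Px)) (linear0 counit)).
exists e => i c Vc; have Wc : coefs (W i) (piH c) by apply: coefs_res.
have [gi|/eqP gi] := eqVneq (gen i) g.
  rewrite eP ?mul1r ?hopf_counit //.
  exact: (coefs_of_mem (V := W) (S := fun i => gen i = g) gi Wc).
rewrite mul0r; apply: eN.
exact: (coefs_of_mem (V := W) (S := fun i => gen i <> g) gi Wc).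
Qed.

(** Such coefficients span A. *)
Lemma total_ext (M : lmodType k) (f h : {linear A -> M}) :
  (forall i c, coefs (V i) c -> f c = h c) -> f =1 h.
Proof.
move=> fh x; apply/subr0_eq.
apply: (coefs_of_total hA hV x (subspace_ker (f \- h : {linear A -> M}))) => c [i [_ Vc]] /=.
by rewrite (fh i c Vc) subrr.
Qed.

Local Notation kG := (group_algebra k G).

Definition is_degree_map (q : A -> kG) : Prop :=
  forall i c, coefs (V i) c -> q c = (counit c : k) *: delta k (gen i).

(** The coefficient at g of q x is the value of the degree g functional at piH x.
    Only finitely many of these are nonzero, since x is a finite sum of
    coefficients of simple comodules. *)
Lemma exists_degree_map : exists q : {linear A -> kG},
  is_degree_map q /\ forall x, piH x = 0 -> q x = 0.
Proof.
have [e eE] := choice exists_degree_functional.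
have ex x : exists z : kG, forall g, coefficient g z = e g (piH x).
  pose P x := exists z : kG, forall g, coefficient g z = e g (piH x).
  apply: (coefs_of_total hA hV x (P := P)); rewrite /P.
    split=> [|a y z [y' y'E] [z' z'E]]; first by exists 0 => g; rewrite coefficient0 !linear0.
    by exists (a *: y' + z') => g; rewrite coefficientP !linearP y'E z'E.
  move=> c [i [_ Vc]]; exists ((counit c : k) *: delta k (gen i)) => g.
  by rewrite coefficientZ coefficient_delta (eE g i c Vc) mulrC eq_sym.
have [q0 q0E] := choice ex.
have [q qE] : exists q : {linear A -> kG}, q =1 q0.
  apply: bundle_linear => a x y; apply: coefficient_inj => g.
  by rewrite coefficientP !q0E !linearP.
exists q; split=> [i c Vc|x px0]; rewrite qE; apply: coefficient_inj => g.
  by rewrite q0E (eE g i c Vc) coefficientZ coefficient_delta mulrC eq_sym.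
by rewrite q0E px0 linear0 coefficient0.
Qed.

Section DegreeMap.
Variables (q : {linear A -> kG}) (hq : is_degree_map q).

Lemma coefs_split i c : coefs (V i) c -> exists s : seq (A * A),
  (forall p, p \in s -> coefs (V i) p.1 /\ coefs (V i) p.2)
  /\ comul c = \sum_(p <- s) p.1 ⊗ p.2.
Proof. by move=> Vc; have [s] := (coefs_subcoalgebra (V i)).2 c Vc; exists s. Qed.

Lemma degree_map1 : q 1 = 1.
Proof.
have [i [V1 g1]] := unit_index.
by rewrite (hq V1) g1 counit1 scale1r.
Qed.

(** The product of coefficients of V i and V j is a sum of coefficients of those
    V w with a nonzero map to V i ⊗ V j, for which gen w = gen i * gen j. *)
Lemma degree_mapM x y : q (x * y) = q x * q y.
Proof.
have [l lE] := bundle_linear ((mul_bilin A).1 y).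
have [r rE] := bundle_linear ((mul_bilin kG).1 (q y)).
rewrite -lE -rE.
apply: (total_ext (f := q \o l) (h := r \o q)) => i c Vc /=; rewrite lE rE.
have [l2 l2E] := bundle_linear ((mul_bilin A).2 c).
have [r2 r2E] := bundle_linear ((mul_bilin kG).2 (q c)).
rewrite -l2E -r2E.
apply: (total_ext (f := q \o l2) (h := r2 \o q)) => j d Vd /=; rewrite l2E r2E.
rewrite (hq Vc) (hq Vd) -scalerAl -scalerAr scalerA deltaM.
have [m mE] : exists m : {linear A -> kG}, m =1
    (fun x => (counit x : k) *: delta k (gen i * gen j)%g).
  by apply: bundle_linear => a u v; rewrite linearP scalerDl scalerA.
rewrite -counitM -mE; apply/subr0_eq.
apply: (coefs_decomposition hA hV (coefs_mul Vc Vd) (subspace_ker (q \- m : {linear A -> kG}))).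
move=> e [w [hw Ve]] /=; have gw := chain_gen_mul (hom_nonzero_res piH hw).
by rewrite mE (hq Ve) gw subrr.
Qed.

Lemma degree_map_comul x : comul (q x) = tens_map q q (comul x).
Proof.
apply: (total_ext (f := comul \o q) (h := tens_map q q \o comul)) => i c Vc.
rewrite -[LHS]/(comul (q c)) -[RHS]/(tens_map q q (comul c)).
have [s [sV cE]] := coefs_split Vc.
have cc : (counit c : k) = \sum_(p <- s) counit p.1 * counit p.2.
  rewrite -{1}[c]comul_counitl cE (linear_sum (slicel counit)) linear_sum.
  by apply: eq_bigr => p _; rewrite /= slicel_pure linearZ_LR.
have dd : comul (delta k (gen i)) = delta k (gen i) ⊗ delta k (gen i) by apply: gcomul_delta.
rewrite (hq Vc) (linearZ_LR comul) [in LHS]/= dd cc cE (linear_sum (tens_map q q)).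
rewrite scaler_suml big_seq [RHS]big_seq; apply: eq_bigr => p /sV [V1 V2].
by rewrite [RHS](tens_map_pure q q) (hq V1) (hq V2) pureZl pureZr scalerA.
Qed.

Lemma degree_map_counit x : counit (q x) = counit x.
Proof.
apply: (total_ext (f := counit \o q) (h := counit)) => i c Vc /=.
rewrite (hq Vc) linearZ_LR /=.
have -> : counit (delta k (gen i)) = 1 by apply: gcounit_delta.
by rewrite /GRing.scale /= mulr1.
Qed.

(** Applying q to c_1 S(c_2) = ε(c) gives gen i * q (S c) = ε(c), because q c_1 =
    ε(c_1) gen i. *)
Lemma degree_map_antipode x : antipode (q x) = q (antipode x).
Proof.
apply: (total_ext (f := antipode \o q) (h := q \o antipode)) => i c Vc /=.
have [s [sV cE]] := coefs_split Vc.
have mb : bilin (fun a b : A => a * antipode b).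
  by apply: (bilin_comp (f := idfun) (g := antipode) (mul_bilin A)) => //; apply: linearP.
have [m mE] := bundle_linear (tens_lift_linear mb).
have E : delta k (gen i) * q (antipode c) = (counit c : k) *: 1.
  transitivity (q (tens_lift (fun a b => a * antipode b) (comul c))); last first.
    by rewrite antipoder linearZ_LR /= degree_map1.
  rewrite -mE -{1}[c]comul_counitl cE (linear_sum (slicel counit)).
  rewrite (linear_sum antipode) (linear_sum q) (linear_sum m) (linear_sum q) mulr_sumr.
  rewrite big_seq [RHS]big_seq; apply: eq_bigr => p /sV [V1 V2].
  rewrite /= mE (tens_lift_pure mb) degree_mapM (hq V1) slicel_pure !linearZ_LR /=.
  by rewrite -scalerAl -scalerAr.
have -> : q (antipode c) = delta k (gen i)^-1%g * (delta k (gen i) * q (antipode c)).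
  by rewrite mulrA deltaM mulVg delta1 mul1r.
rewrite E (hq Vc) linearZ_LR /= -scalerAr mulr1; congr (_ *: _).
exact: gantipode_delta.
Qed.

Lemma degree_map_hopf : exists f : hopfMor A kG, forall x, f x = q x.
Proof.
pose m1 := GRing.isMonoidMorphism.Build A kG q (degree_map1, degree_mapM).
pose m2 := GRing.isLinear.Build k A kG *:%R q (linearP q).
pose f : {lrmorphism A -> kG} := HB.pack (q : A -> kG) m1 m2.
have fc x : comul (f x) = tens_map f f (comul x) by exact: degree_map_comul.
have fe x : counit (f x) = counit x by exact: degree_map_counit.
have fa x : antipode (f x) = f (antipode x) by exact: degree_map_antipode.
by exists (HopfMor fc fe fa).
Qed.

End DegreeMap.
End ChainGrading.

(** * The degree map is central and surjective *)

Section ChainCenter.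
Variables (k : fieldType) (A B : hopfType k) (piH : hopfMor A B).
Hypotheses (hA : cosemisimple A) (hB : cosemisimple B).
Variables (I : choiceType) (V : I -> comodule A) (hV : simple_classes V).

Local Notation G := (chain_group piH V).
Local Notation gen := (chain_gen piH V).
Local Notation kG := (group_algebra k G).

Lemma simple_coef_counit i : exists2 c, coefs (V i) c & (counit c : k) = 1.
Proof.
have [Vs _ _] := hV; have [[v /eqP v0] _] := Vs i.
have [f [_ f1]] := separation (subspace_zero (V i)) v0.
by exists (coef f v); [exact: coefs_mem|rewrite counit_coef].
Qed.

(** Both sides are gen i ⊗ c for c a coefficient of V i, since its coproduct is
    a sum of tensors of coefficients of V i. *)
Lemma degree_map_central (q : {linear A -> kG}) : is_degree_map (piH := piH) (V := V) q ->
  forall x, tens_map q idfun (comul x) = tens_map q idfun (tens_swap (comul x)).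
Proof.
move=> hq; apply: (total_ext hA hV (f := tens_map q idfun \o comul)
  (h := tens_map q idfun \o @tens_swap _ A A \o comul)) => i c Vc.
rewrite -[LHS]/(tens_map q idfun (comul c)) -[RHS]/(tens_map q idfun (tens_swap (comul c))).
have [s [sV cE]] := coefs_split Vc.
transitivity (delta k (gen i) ⊗ c).
  rewrite -[c in RHS]comul_counitl cE (linear_sum (tens_map q idfun)).
  rewrite (linear_sum (slicel counit)) pure_sumr big_seq [RHS]big_seq.
  apply: eq_bigr => p /sV [V1 V2].
  by rewrite [LHS](tens_map_pure q idfun) /= slicel_pure (hq i _ V1) pureZlr.
rewrite -[c in LHS]comul_counitr cE (linear_sum (@tens_swap _ A A)).
rewrite (linear_sum (slicer counit)) (linear_sum (tens_map q idfun)) pure_sumr.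
rewrite big_seq [RHS]big_seq; apply: eq_bigr => p /sV [V1 V2] /=.
by rewrite tens_swap_pure (tens_map_pure q idfun) slicer_pure (hq i _ V2) pureZlr.
Qed.

(** The image is closed under products and the antipode and contains all
    generators, hence all words. *)
Lemma degree_map_surjective (q : {linear A -> kG}) : is_degree_map (piH := piH) (V := V) q ->
  forall z, exists x, q x = z.
Proof.
move=> hq.
have qd g : exists x, q x = delta k g.
  rewrite -[g]word_classK; elim: (repr g) => [|[b i] s [x xE]].
    by exists 1; rewrite (degree_map1 hB hV hq).
  have -> : word_class (chain_rel piH V) ((b, i) :: s)
      = ((word_class (chain_rel piH V) [:: (b, i)] : G) * word_class (chain_rel piH V) s)%g.
    by apply/esym; apply: (pmulE (chain_rel piH V) [:: (b, i)] s).
  rewrite -deltaM -xE.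
  suff [y <-] : exists y, q y = delta k (word_class (chain_rel piH V) [:: (b, i)] : G).
    by exists (y * x); rewrite (degree_mapM hA hV hq).
  have [c Vc c1] := simple_coef_counit i.
  case: b; first by exists c; rewrite (hq i c Vc) c1 scale1r.
  exists (antipode c).
  rewrite -(degree_map_antipode hA hB hV hq) (hq i c Vc) c1 scale1r.
  rewrite [LHS]gantipode_delta; congr (delta k _); apply: (@mulgI _ (gen i)).
  rewrite mulgV; apply/esym.
  apply: etrans (pmulE (chain_rel piH V) [:: (true, i)] [:: (false, i)]) _.
  by apply/word_classP; apply: (@word_eq_cancel _ _ true i).
move=> z; rewrite [z]group_algebra_sum.
elim/big_ind: _ => [|_ _ [x <-] [y <-]|g _]; first by exists 0; rewrite linear0.
  by exists (x + y); rewrite linearD.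
by have [x <-] := qd g; exists (coefficient g z *: x); rewrite linearZ.
Qed.

End ChainCenter.

(** * The relative center *)

Section RelativeCenter.
Variables (k : closedFieldType) (A B : hopfType k) (piH : hopfMor A B).
Hypotheses (hA : cosemisimple A) (hB : cosemisimple B) (hH : hopf_surjective piH).
Variables (Z : hopfType k) (piZ : hopfMor A Z) (hZ : is_center piZ).
Variables (R : hopfType k) (rho : hopfMor A R) (hR : is_intersection piZ piH rho).
Variables (I : choiceType) (V : I -> comodule A) (hV : simple_classes V).

Local Notation G := (chain_group piH V).
Local Notation gen := (chain_gen piH V).
Local Notation kG := (group_algebra k G).

(** The degree map kills ker piZ by the universal property of the center, and
    ker piH by construction. *)
Lemma intersection_degree_map : exists q : {linear R -> kG},
  is_degree_map (piH := piH) (V := V) (q \o rho).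
Proof.
have [q [hq qH]] := exists_degree_map piH hA hB hV.
have [f fq] := degree_map_hopf hA hB hV hq.
have [_ _ Zuniv] := hZ.
have fsurj : hopf_surjective f.
  by move=> y; have [x <-] := degree_map_surjective hA hB hV hq y; exists x; rewrite fq.
have fcentral : hopf_central f.
  move=> x; have fE (y : tensor A A) : tens_map f idfun y = tens_map q idfun y.
    exact: eq_tens_map.
  by rewrite !fE (degree_map_central hA hV hq).
have [t tE] := Zuniv _ f fsurj fcentral.
have qZ x : piZ x = 0 -> q x = 0 by move=> x0; rewrite -fq tE x0 linear0.
have [|q' q'E] := factor_through (f := rho) (g := q) hR.1.
  by move=> x /(hR.2 x).1 [y [z [y0 z0 ->]]]; rewrite linearD qZ // qH // addr0.
by exists q' => i c Vc; rewrite /= -q'E; apply: hq.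
Qed.

(** rho factors through piZ, which is central. *)
Lemma intersection_central : hopf_central rho.
Proof.
have [psurj pcentral _] := hZ.
have [|t tE] := factor_through (f := piZ) (g := rho) psurj.
  by move=> x x0; apply: (hR.2 x).2; exists x, 0; split=> //; rewrite ?addr0 ?linear0.
have E (y : tensor A A) : tens_map rho idfun y = tens_map t idfun (tens_map piZ idfun y).
  by rewrite tens_map_comp; apply: eq_tens_map.
by move=> x; rewrite !E pcentral.
Qed.

Lemma intersection_factor : exists t : {linear B -> R}, forall x, rho x = t (piH x).
Proof.
apply: (factor_through hH) => x x0.
by apply/(hR.2 x).2; exists 0, x; split; [exact: linear0| |rewrite add0r].
Qed.

Variables (r : I -> R).
Hypothesis Vr : forall i (v : V i), coact (c := res_comod rho (V i)) v = v ⊗ r i.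
Local Notation S := (@antipode k R).

Lemma central_grouplike i : comul (r i) = r i ⊗ r i /\ counit (r i) = 1.
Proof.
have [Vs _ _] := hV; have [[v v0] _] := Vs i.
exact: (scalar_grouplike (M := res_comod rho (V i)) (@Vr i) v0).
Qed.

Lemma rho_coef i c : coefs (V i) c -> rho c = (counit c : k) *: r i.
Proof.
move=> Vc.
have [l lE] : exists l : {linear A -> R}, l =1 (fun c => (counit c : k) *: r i).
  by apply: bundle_linear => a x y; rewrite linearP scalerDl scalerA.
rewrite -lE; apply/subr0_eq.
apply: (Vc _ (subspace_ker (rho \- l : {linear A -> R}))) => _ [f [v ->]] /=.
rewrite lE -coef_res (scalar_coef (M := res_comod rho (V i)) (@Vr i)) counit_coef.
by rewrite subrr.
Qed.

(** A B-colinear map f is R-colinear, because rho factors through piH.  On f x the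
    coaction of R is then given both by r u and by r v * r w. *)
Lemma central_mul u v w :
  hom_nonzero (res_comod piH (V u)) (res_comod piH (tens_comod (V v) (V w))) ->
  r u = r v * r w.
Proof.
move=> [f fc [x /eqP fx]].
have [t tE] := intersection_factor.
have fR y : coact (c := res_comod rho (tens_comod (V v) (V w))) (f y) = f y ⊗ r u.
  transitivity (tens_map idfun t (coact (c := res_comod piH (tens_comod (V v) (V w))) (f y))).
    by rewrite /= /res_coact /= tens_map_comp; apply: eq_tens_map.
  rewrite fc tens_map_comp.
  transitivity (tens_map f idfun (coact (c := res_comod rho (V u)) y)).
    by rewrite /= /res_coact /= !tens_map_comp; apply: eq_tens_map => // a; rewrite /= tE.
  by rewrite Vr (tens_map_pure f idfun).
have := fR x; rewrite (res_scalar_tensor (@Vr v) (@Vr w)) => E.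
have [h [_ h1]] := separation (subspace_zero _) fx.
by have := congr1 (slicel h) E; rewrite !slicel_pure h1 !scale1r.
Qed.

Lemma central_inv i : r i * S (r i) = 1 /\ S (r i) * r i = 1.
Proof.
have [rr re] := central_grouplike i.
have b1 : bilin (fun a b : R => a * S b).
  by apply: (bilin_comp (f := idfun) (g := S) (mul_bilin R)) => //; apply: linearP.
have b2 : bilin (fun a b : R => S a * b).
  by apply: (bilin_comp (f := S) (g := idfun) (mul_bilin R)) => //; apply: linearP.
have := antipoder (r i); have := antipodel (r i).
by rewrite rr re scale1r (tens_lift_pure b1) (tens_lift_pure b2) => -> ->.
Qed.

(** The extension of i |-> r i to words; S (r i) is the inverse of the grouplike
    element r i. *)
Definition word_value (s : word I) : R :=
  \prod_(p <- s) (if p.1 then r p.2 else S (r p.2)).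

Lemma word_value_eq s t : word_eq (chain_rel piH V) s t -> word_value s = word_value t.
Proof.
rewrite /word_value; elim=> {s t} //.
- move=> _ _ [u [v [w [h -> ->]]]].
  by rewrite !big_cons !big_nil /= !mulr1; apply: central_mul.
- move=> b i; rewrite !big_cons !big_nil /= mulr1.
  by have [rS Sr] := central_inv i; case: b.
- by move=> t s u _ -> _ ->.
by move=> s s' t t' _ E _ E'; rewrite !big_cat /= E E'.
Qed.

Lemma central_gen_eq i j : gen i = gen j -> r i = r j.
Proof.
by move=> /word_classP/word_value_eq; rewrite /word_value !big_seq1.
Qed.

Lemma central_gen_mul i j l : gen l = (gen i * gen j)%g -> r l = r i * r j.
Proof.
move=> E.
have {}E : word_class (chain_rel piH V) [:: (true, l)]
    = word_class (chain_rel piH V) [:: (true, i); (true, j)].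
  exact: etrans E (pmulE (chain_rel piH V) [:: (true, i)] [:: (true, j)]).
have := word_value_eq ((word_classP _ _ _).1 E).
by rewrite /word_value !big_cons !big_nil /= !mulr1.
Qed.

Variables (q : {linear R -> kG}).
Hypothesis hq : is_degree_map (piH := piH) (V := V) (q \o rho).

Lemma degree_central i : q (r i) = delta k (gen i).
Proof.
have [c Vc c1] := simple_coef_counit hV i.
have := hq Vc; rewrite /= (rho_coef Vc) c1 !scale1r; exact.
Qed.

(** If no generator were equal to g, the coefficient at g would vanish on the whole
    image of the degree map, which contains g. *)
Lemma gen_surjective g : exists i, gen i = g.
Proof.
apply: contrapT => /forallNP ng.
have [x xg] := degree_map_surjective hA hB hV hq (delta k g).
pose P x := coefficient g (q (rho x)) = 0.
have Px : P x.
  apply: (coefs_of_total hA hV x (P := P)); rewrite /P.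
    split=> [|a y z y0 z0]; first by rewrite (linear0 rho) (linear0 q); apply: coefficient0.
    by rewrite (linearP rho) (linearP q) [LHS]coefficientP y0 z0 mulr0 addr0.
  move=> c [i [_ Vc]]; have /= -> := hq Vc; rewrite coefficientZ coefficient_delta.
  by have [/esym/ng|] := eqVneq g (gen i); rewrite ?mulr0.
move: Px xg; rewrite /P /= => + xg; rewrite xg coefficient_delta eqxx => /eqP.
by rewrite oner_eq0.
Qed.

(** psi sends g to the grouplike element of degree g, and psi after q fixes each r i;
    these span R.  In particular q is injective. *)
Lemma central_reconstruction : exists psi : {linear kG -> R}, forall b, psi (q b) = b.
Proof.
have [s sK] := choice gen_surjective.
exists (linearize (fun g => r (s g))) => b; have [x <-] := hR.1 b.
apply: (total_ext hA hV (f := linearize (fun g => r (s g)) \o (q \o rho)) (h := rho)) => i c Vc.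
have := hq Vc; rewrite /= => ->; rewrite linearZ_LR /= linearize_delta (rho_coef Vc).
by congr (_ *: _); apply: central_gen_eq; apply: sK.
Qed.

(** R is spanned by the r i, and on these h is the indicator of degree g. *)
Lemma slice_comul_degree g i (b : R) (h : dual R) : gen i = g ->
  (forall b, h b = coefficient g (q b)) ->
  slicer h (comul b) = (h b : k) *: r i.
Proof.
move=> gi hE; have [x <-] := hR.1 b.
have [l lE] : exists l : {linear R -> R}, l =1 (fun b => (h b : k) *: r i).
  by apply: bundle_linear => a u v; rewrite linearP scalerDl scalerA.
rewrite -lE.
apply: (total_ext hA hV (f := slicer h \o (comul \o rho)) (h := l \o rho)) => j c Vc /=.
rewrite lE (rho_coef Vc) !linearZ_LR /= (central_grouplike j).1 slicer_pure scalerA.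
rewrite hE degree_central coefficient_delta.
have [gj|_] := eqVneq g (gen j); last by rewrite mulr0 scaler0 !scale0r.
by rewrite (@central_gen_eq i j) ?gi.
Qed.

(** Take m nonzero in M.  Some component m_g = h_g(m_1) m_0 is nonzero, because the
    functionals h_g, the coordinates of q, separate the points of R.  The coaction
    on m_g is scalar by [slice_comul_degree]. *)
Lemma simple_grouplike (M : comodule R) : simple_comodule M ->
  exists i, comod_iso (grouplike_comod (central_grouplike i).1 (central_grouplike i).2) M.
Proof.
move=> Ms; have [[m m0] _] := Ms.
have [psi psiK] := central_reconstruction.
have hex g : exists h : dual R, forall b, h b = coefficient g (q b).
  apply: (@bundle_linear k R k^o (fun b => coefficient g (q b))) => a x y.
  by rewrite linearP [LHS]coefficientP.
have [h hE] := choice hex.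
(* If all components vanish, so do all coefficients of m, as q is injective. *)
have [g mg] : exists g, act (h g) m != 0.
  apply: contrapT => /forallNP nz; case/eqP: m0; apply: separating => f.
  rewrite -counit_coef -[coef f m]psiK.
  suff -> : q (coef f m) = 0 by rewrite !linear0.
  apply: coefficient_inj => g; rewrite -hE act_coef coefficient0.
  by have /negP/negPn/eqP -> := nz g; rewrite linear0.
have [i gi] := gen_surjective g; exists i.
apply: (grouplike_iso _ _ Ms mg).
rewrite coact_act.
have [l lE] := bundle_linear ((pure_bilin M R).1 (r i)).
rewrite -lE; apply: (tens_linear_ext (f := tens_map idfun (slicer (h g) \o comul))
  (g := l \o slicer (h g))) => u b /=.
rewrite lE (tens_map_pure idfun (slicer (h g) \o comul)) /= slicer_pure.
by rewrite (slice_comul_degree b gi (hE g)) pureZlr.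
Qed.

End RelativeCenter.

Theorem theorem0p3 (k : closedFieldType) (A B : hopfType k)
  (piH : hopfMor A B)
  (hA : cosemisimple A) (hB : cosemisimple B) (hH : hopf_surjective piH)
  (Z : hopfType k) (piZ : hopfMor A Z) (hZ : is_center piZ)
  (R : hopfType k) (rho : hopfMor A R) (hR : is_intersection piZ piH rho)
  (I : choiceType) (V : I -> comodule A) (hV : simple_classes V)
  (J : choiceType) (W : J -> comodule R) (hW : simple_classes W) :
  exists phi : chain_group piH V -> J,
    [/\ forall i, sum_of_copies (res_comod rho (V i)) (W (phi (chain_gen piH V i))),
        forall x y, tensor_class W (phi x) (phi y) (phi (x * y)%g)
      & bijective phi].
Proof.
have [q hq] := intersection_degree_map hA hB hZ hR hV.
have rho_central := intersection_central hZ hR.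
have [Vs _ _] := hV; have [_ Wuniq Wall] := hW.
have [r Vr] := choice (fun i => central_scalar rho_central (Vs i)).
have gl i := central_grouplike hV Vr i.
pose K i := grouplike_comod (gl i).1 (gl i).2.
have [s sK] := choice (gen_surjective hA hB hV hq).
have [j jK] := choice (fun i => Wall (K i) (grouplike_simple (gl i).1 (gl i).2)).
have gen_eq := central_gen_eq hH hR hV Vr.
exists (fun g => j (s g)); split.
- move=> i; have [n [e [eM ei]]] := simple_spanned (Vs i).
  apply: (scalar_sum_of_copies (M := res_comod rho (V i)) (n := n) (e := e) _ eM ei (jK _)) => v.
  by rewrite (gen_eq _ i) ?sK.
- move=> x y; apply: (grouplike_tensor_iso (jK _) (jK _) (jK _)).
  by apply: (central_gen_mul hH hR hV Vr); rewrite !sK.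
have phi_inj : injective (fun g => j (s g)).
  move=> x y jxy; have Kxy : comod_iso (K (s x)) (K (s y)).
    by apply: comod_iso_trans (jK _) _; rewrite jxy; apply/comod_iso_sym/jK.
  have := congr1 (coefficient x \o q) (grouplike_iso_eq Kxy).
  rewrite /= !(degree_central hV Vr hq) !sK !coefficient_delta eqxx.
  by case: eqVneq => // _ /eqP; rewrite oner_eq0.
have surj l : exists g, j (s g) = l.
  have [Ws _ _] := hW; have [i Ki] := simple_grouplike hA hB hH hR hV Vr hq (Ws l).
  exists (chain_gen piH V i); apply: Wuniq.
  apply: comod_iso_trans (comod_iso_sym (jK _)) _; apply: comod_iso_trans Ki.
  by apply: grouplike_eq_iso; apply: gen_eq; rewrite sK.
have [psi psiK] := choice surj.
by exists psi => // x; apply: phi_inj; rewrite psiK.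
Qed.
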